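(* There is an integer $N$ such that for all $n\ge N$ the following holds. Let $G$ be a connected $n$-vertex outerplanar graph whose spread is maximum among all $n$-vertex outerplanar graphs, let $\mathbf{x}$ be an eigenvector of the adjacency matrix of $G$ for its largest eigenvalue $\lambda_1$ with all entries positive, normalized so that its maximum entry equals $1$, and let $w$ be any vertex with $\mathbf{x}_w=1$. Then $w$ has degree $n-1$.
   Context: For a graph $G$ with adjacency eigenvalues $\lambda_1\ge\cdots\ge\lambda_n$, the spread is $S(G)=\lambda_1-\lambda_n$. A graph is outerplanar if it can be drawn in the plane without crossings so that all vertices lie on the unbounded face. *)

(* Defs.v *)
From HB Require Import structures.
From mathcomp Require Import all_boot all_order all_algebra.
From mathcomp Require Import all_classical all_reals all_analysis.
Set Implicit Arguments.
Unset Strict Implicit.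
Unset Printing Implicit Defensive.
Import Order.TTheory GRing.Theory Num.Theory.
Import numFieldNormedType.Exports.

Local Open Scope classical_set_scope.
Local Open Scope ring_scope.

Record sgraph (n : nat) := SGraph {
  adj :> rel 'I_n;
  adj_sym : symmetric adj;
  adj_irrefl : irreflexive adj }.

Definition sgraph_connected (n : nat) (G : sgraph n) : Prop :=
  forall u v : 'I_n, connect G u v.

Definition degree (n : nat) (G : sgraph n) (v : 'I_n) : nat :=
  #|[pred u | G v u]|.

Definition adj_mx (R : realType) (n : nat) (G : sgraph n) : 'M[R]_n :=
  \matrix_(i, j) (G i j)%:R.

(* A real symmetric matrix of positive size has a nonempty finite set of real
   eigenvalues, and all its complex eigenvalues are real, so this sup and inf
   are the largest and the smallest eigenvalue, lambda_1 and lambda_n. *)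
Definition lambda_max (R : realType) (n : nat) (G : sgraph n) : R :=
  sup [set a : R | eigenvalue (adj_mx R G) a].

Definition lambda_min (R : realType) (n : nat) (G : sgraph n) : R :=
  inf [set a : R | eigenvalue (adj_mx R G) a].

Definition spread (R : realType) (n : nat) (G : sgraph n) : R :=
  lambda_max R G - lambda_min R G.

Definition is_arc (R : realType) (A : set (R * R)) (p q : R * R) : Prop :=
  exists gamma : R -> R * R,
    [/\ {within `[0, 1], continuous gamma},
        {in `[0, 1] &, injective gamma},
        gamma 0 = p, gamma 1 = q & A = gamma @` `[0, 1]].

(* Crossing-free drawing of G: the vertex v is the point pos v and the edge uv
   is the arc edge u v.  Together, the last two conditions say that two distinct
   edges meet at most in the points of their common endpoints. *)
Record is_plane_drawing (R : realType) (n : nat) (G : sgraph n)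
    (pos : 'I_n -> R * R) (edge : 'I_n -> 'I_n -> set (R * R)) : Prop := {
  pos_inj : injective pos;
  edge_sym : forall u v, G u v -> edge u v = edge v u;
  edge_arc : forall u v, G u v -> is_arc (edge u v) (pos u) (pos v);
  edge_vertex : forall u v w, G u v -> edge u v (pos w) -> w = u \/ w = v;
  edge_cross : forall u v x y, G u v -> G x y ->
    (u, v) != (x, y) -> (u, v) != (y, x) ->
    edge u v `&` edge x y `<=` range pos }.

Definition drawing_support (R : realType) (n : nat) (G : sgraph n)
    (pos : 'I_n -> R * R) (edge : 'I_n -> 'I_n -> set (R * R)) : set (R * R) :=
  range pos `|` [set p | exists u v, G u v /\ edge u v p].

Definition is_face (R : realType) (D F : set (R * R)) : Prop :=
  exists2 p, (~` D) p & F = connected_component (~` D) p.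

(* Faces are open and disjoint from the vertices, so a vertex lies on (the
   boundary of) a face exactly when it lies in its closure. *)
Definition outerplanar (R : realType) (n : nat) (G : sgraph n) : Prop :=
  exists (pos : 'I_n -> R * R) (edge : 'I_n -> 'I_n -> set (R * R)),
    is_plane_drawing G pos edge /\
    exists F : set (R * R),
      [/\ is_face (drawing_support G pos edge) F,
          ~ bounded_set F &
          forall v, closure F (pos v)].

(* Main.v *)
(** If the hub w misses some vertex, G has smaller spread than a join of one
    vertex with disjoint paths on three vertices and isolated vertices.

    Outerplanarity enters only through the exclusion of K_{2,3}: a point of the
    outer face, joined to three vertices, would complete a subdivided K_{2,3} to
    a drawing of K_{3,3} in which independent edges are disjoint.  For such a
    pair of edges the map (s, t) |-> e(s) - e'(t) avoids 0 on a square, so its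
    boundary has even winding parity; summing over the 18 independent pairs,
    every winding parity cancels and an odd constant remains.  Hence codegrees
    are at most 2, and the levels of a breadth-first search give at most 8n
    ordered adjacent pairs.

    Put S = sqrt n.  These two facts bound all eigenvalues by S + 8, and when
    the spread is near 2S they force the extremal eigenvectors to peak at one
    common vertex w of degree n - O(S), all other entries being O(1/S).
    Eliminating the entry at w expands a^4 in walks of G - w and yields
    a^4 <= d a^2 + h a + 2 h + O(S), where d = deg w and h counts the ordered
    adjacent pairs inside N(w).  If d <= n - 2, every value of h leads to a
    spread of at most 2S - 0.6/S, whereas the explicit graph reaches 2S - 0.5/S. *)

Require Import Defs.
From mathcomp Require Import all_boot all_order all_algebra.
From mathcomp Require Import all_classical all_reals all_analysis.
From mathcomp Require Import zify lra ring.
Set Implicit Arguments.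
Unset Strict Implicit.
Unset Printing Implicit Defensive.
Import Order.TTheory GRing.Theory Num.Theory.
Import numFieldNormedType.Exports.
Local Open Scope classical_set_scope.
Local Open Scope ring_scope.

(** * Winding parity of discrete chains *)

Section Parity.
Variable R : realDomainType.
Implicit Types (a b c d p z w : R * R) (s t : seq (R * R)).

(* The tie-break on the axis gives [upper (- z) = ~~ upper z] for all [z != 0]. *)
Definition upper z := (0 < z.2) || ((z.2 == 0) && (0 < z.1)).

(* Whether the step from z to w crosses the negative x-axis, for short steps far
   from the origin. *)
Definition cross z w := (upper z (+) upper w) && (z.1 < 0).

Fixpoint winding p a s : bool :=
  if s is b :: s' then cross (a - p) (b - p) (+) winding p b s' else false.

Definition close_pt (eta : R) a b := (`|a.1 - b.1| < eta) && (`|a.2 - b.2| < eta).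

(** The negation of [close_pt delta]: sup-norm distance at least [delta]. *)
Definition far_pt (delta : R) a b := (delta <= `|a.1 - b.1|) || (delta <= `|a.2 - b.2|).

Lemma far_pt_sym delta : symmetric (far_pt delta).
Proof. by move=> a b; rewrite /far_pt (distrC a.1) (distrC a.2). Qed.

Lemma close_pt_sym eta : symmetric (close_pt eta).
Proof. by move=> a b; rewrite /close_pt (distrC a.1) (distrC a.2). Qed.

Variables (delta eta : R).
Hypotheses (eta_gt0 : 0 < eta) (eta_le : eta + eta <= delta).

Lemma upperN a b : far_pt delta a b -> upper (b - a) = ~~ upper (a - b).
Proof.
case: a b => [a1 a2] [b1 b2]; rewrite /far_pt /upper /= => H.
rewrite !subr_gt0 !subr_eq0.
case: (ltgtP a2 b2) => //= h2; case: (ltgtP a1 b1) => //= h1.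
by exfalso; move: H; rewrite h1 h2 !subrr !normr0 => /orP[]; move: eta_gt0 eta_le; lra.
Qed.

Lemma far_ptP a b : far_pt delta a b ->
  [\/ delta <= a.1 - b.1, a.1 - b.1 <= - delta,
      delta <= a.2 - b.2 | a.2 - b.2 <= - delta].
Proof.
move=> /orP[]; rewrite ler_normr => /orP[h|h].
- by constructor 1.
- by constructor 2; lra.
- by constructor 3.
- by constructor 4; lra.
Qed.

Lemma close_ptP a b : close_pt eta a b ->
  [/\ a.1 - b.1 < eta, b.1 - a.1 < eta, a.2 - b.2 < eta & b.2 - a.2 < eta].
Proof.
by case/andP; rewrite !ltr_norml => /andP[h1 h2] /andP[h3 h4]; split; lra.
Qed.

Lemma upper_pos z : 0 < z.2 -> upper z.
Proof. by rewrite /upper => ->. Qed.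

Lemma upper_neg z : z.2 < 0 -> upper z = false.
Proof. by move=> h; rewrite /upper lt_gtF //= lt_eqF. Qed.

(** As [eta + eta <= delta], the four differences lie in one open half-plane bounded by a coordinate
    axis, and a closed quadrilateral there crosses the negative x-axis an even number of times. *)
Lemma cross_cell a b c d : far_pt delta a c -> close_pt eta a b -> close_pt eta c d ->
  cross (a - c) (b - c) (+) cross (b - c) (b - d) (+) cross (a - c) (a - d)
    (+) cross (a - d) (b - d) = false.
Proof.
move=> /far_ptP fac /close_ptP[h1 h2 h3 h4] /close_ptP[k1 k2 k3 k4].
rewrite /cross.
case: fac => h.
- by rewrite !(@lt_gtF _ _ 0) ?andbF //=; move: eta_gt0 eta_le; lra.
- have -> : (a - c).1 < 0 by rewrite /=; move: eta_gt0 eta_le; lra.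
  have -> : (b - c).1 < 0 by rewrite /=; move: eta_gt0 eta_le; lra.
  have -> : (a - d).1 < 0 by rewrite /=; move: eta_gt0 eta_le; lra.
  by do 4 case: (upper _).
- by rewrite !upper_pos //=; move: eta_gt0 eta_le; lra.
- by rewrite !upper_neg //=; move: eta_gt0 eta_le; lra.
Qed.

(** Negation exchanges crossings of the negative and of the positive half-axis; for a short step far
    from 0, the two together tell whether [upper] changes. *)
Lemma crossN a c d : far_pt delta a c -> far_pt delta a d -> close_pt eta c d ->
  cross (a - c) (a - d) = cross (c - a) (d - a) (+) upper (c - a) (+) upper (d - a).
Proof.
move=> fac fad /close_ptP[k1 k2 k3 k4].
rewrite /cross (upperN fac) (upperN fad).
case/far_ptP: fac => h.
- rewrite (@lt_gtF _ _ 0) /=; last by move: eta_gt0 eta_le; lra.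
  have -> : (c.1 - a.1 < 0) by move: eta_gt0 eta_le; lra.
  by do 2 case: (upper _).
- rewrite (@lt_gtF _ _ 0 (c - a).1) /=; last by move: eta_gt0 eta_le; lra.
  have -> : (a.1 - c.1 < 0) by move: eta_gt0 eta_le; lra.
  by do 2 case: (upper _).
- by rewrite !upper_pos //=; move: eta_gt0 eta_le; lra.
- by rewrite !upper_neg //=; move: eta_gt0 eta_le; lra.
Qed.

(** Serves the sides of the grid of differences along which the subtracted point moves. *)
Fixpoint cowinding p c t : bool :=
  if t is d :: t' then cross (p - c) (p - d) (+) cowinding p d t' else false.

Lemma cowindingE p c t : all (far_pt delta p) (c :: t) -> path (close_pt eta) c t ->
  cowinding p c t = winding p c t (+) upper (c - p) (+) upper (last c t - p).
Proof.
elim: t c => [|d t IH] c /=; first by rewrite addbb.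
move=> /and3P[fc fd ft] /andP[cd pt].
rewrite IH //=; last by rewrite fd ft.
rewrite crossN //.
by case: (cross _ _); case: (upper _); case: (upper _); case: (upper _); case: (winding _ _ _).
Qed.

Lemma winding_row a s c d : path (close_pt eta) a s -> close_pt eta c d ->
  all (fun p => far_pt delta p c) (a :: s) ->
  winding c a s (+) winding d a s (+) cross (a - c) (a - d)
    (+) cross (last a s - c) (last a s - d) = false.
Proof.
elim: s a => [|b s IH] a /=; first by rewrite addbb.
move=> /andP[ab pt] cd /and3P[fa fb fs].
have := cross_cell fa ab cd; have := IH b pt cd; rewrite /= fb fs => /(_ isT).
by do 4 case: (cross _ _) => //=; do 2 case: (winding _ _ _) => //=; case: (cross _ _).
Qed.

(** Sum of [cross_cell] over all cells: inner sides cancel in pairs and the boundary of the grid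
    remains. *)
Lemma winding_grid a s c t : path (close_pt eta) a s -> path (close_pt eta) c t ->
  allrel (far_pt delta) (a :: s) (c :: t) ->
  winding c a s (+) winding (last c t) a s (+) cowinding a c t
    (+) cowinding (last a s) c t = false.
Proof.
move=> pa; elim: t c => [|d t IH] c; first by rewrite /= addbb.
move=> /= /andP[cd pt]; rewrite allrel_consr => /andP[fc fdt].
have := IH d pt fdt; have := winding_row pa cd fc.
rewrite /=.
by case: (winding d a s); case: (winding c a s); case: (winding (last d t) a s);
  case: (cross _ _); case: (cross _ _); case: (cowinding _ _ _); case: (cowinding _ _ _).
Qed.

Lemma winding_disjoint a s b c t d : last a s = b -> last c t = d ->
  path (close_pt eta) a s -> path (close_pt eta) c t ->
  allrel (far_pt delta) (a :: s) (c :: t) ->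
  winding c a s (+) winding d a s (+) winding a c t (+) winding b c t (+)
   upper (c - a) (+) upper (d - a) (+) upper (c - b) (+) upper (d - b) = false.
Proof.
move=> <- <- pa pc frl.
have := winding_grid pa pc frl.
have H : forall p, p \in a :: s -> all (far_pt delta p) (c :: t).
  by move=> p pin; apply/allP => q qin; move/allrelP: frl; apply.
rewrite !cowindingE ?H ?mem_head ?mem_last //.
by case: (winding _ _ _) => //=; case: (winding _ _ _) => //=; case: (winding _ _ _) => //=;
  case: (winding _ _ _) => //=; do 4 case: (upper _).
Qed.

Lemma addb8_even (b1 b2 b3 b4 b5 b6 b7 b8 : bool) :
  b1 (+) b2 (+) b3 (+) b4 (+) b5 (+) b6 (+) b7 (+) b8 = false ->
  exists k : nat, (b1 + b2 + b3 + b4 + b5 + b6 + b7 + b8 = 2 * k)%N.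
Proof.
move=> h; exists (b1 + b2 + b3 + b4 + b5 + b6 + b7 + b8)./2.
rewrite mul2n -[LHS]odd_double_half !oddD !oddb h add0n //.
Qed.

Lemma nat_of_negb (b : bool) : (~~ b + b = 1)%N.
Proof. by case: b. Qed.

(** Add the parity relations over the 3 pairs [{i, i'}] and the 6 ordered pairs [(j, j')]. Every
    winding, and every sign between two vertices not both among the [v j], occurs an even number of
    times. The signs [VV j j'] and [VV j' j] add up to 1, so they contribute 3 for each pair
    [{i, i'}], hence the odd number 9. *)
Lemma K33_crosses (u v : 'I_3 -> R * R) (s : 'I_3 -> 'I_3 -> seq (R * R)) :
  (forall i j, last (u i) (s i j) = v j) ->
  (forall i j, path (close_pt eta) (u i) (s i j)) ->
  (forall i i' j j', i != i' -> j != j' ->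
    allrel (far_pt delta) (u i :: s i j) (u i' :: s i' j')) -> False.
Proof.
move=> Hl Hp Hf.
pose o0 : 'I_3 := inord 0; pose o1 : 'I_3 := inord 1; pose o2 : 'I_3 := inord 2.
have n01 : o0 != o1 by rewrite -val_eqE /= !inordK.
have n02 : o0 != o2 by rewrite -val_eqE /= !inordK.
have n12 : o1 != o2 by rewrite -val_eqE /= !inordK.
pose W1 i' i j : nat := winding (u i') (u i) (s i j).
pose W2 j' i j : nat := winding (v j') (u i) (s i j).
pose UU i i' : nat := upper (u i' - u i)%R.
pose VU i j : nat := upper (v j - u i)%R.
pose UV i j : nat := ~~ upper (v j - u i)%R.
pose VV j j' : nat := upper (v j' - v j)%R.
have E (i i' j j' : 'I_3) : i != i' -> j != j' -> exists k : nat,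
  (W1 i' i j + W2 j' i j + W1 i i' j' + W2 j i' j'
   + UU i i' + VU i j' + UV i' j + VV j j' = 2 * k)%N.
  move=> ni nj; have frl := Hf _ _ _ _ ni nj.
  have far_vu : far_pt delta (v j) (u i').
    by move/allrelP: frl; apply; rewrite ?mem_head // -(Hl i j) mem_last.
  rewrite /UV -(upperN far_vu); apply: addb8_even.
  exact: winding_disjoint (Hl i j) (Hl i' j') (Hp i j) (Hp i' j') frl.
have sym j j' : j != j' -> (VV j j' + VV j' j = 1)%N.
  move=> nj; have far_vv : far_pt delta (v j) (v j').
    have := Hf _ _ _ _ n01 nj; move/allrelP; apply.
      by rewrite -(Hl o0 j) mem_last.
    by rewrite -(Hl o1 j') mem_last.
  by rewrite /VV (upperN far_vv) nat_of_negb.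
have N i j : (UV i j + VU i j = 1)%N by apply: nat_of_negb.
clearbody W1 W2 UU VU UV VV.
have s01 := sym _ _ n01; have s02 := sym _ _ n02; have s12 := sym _ _ n12.
have n10 : o1 != o0 by rewrite eq_sym.
have n20 : o2 != o0 by rewrite eq_sym.
have n21 : o2 != o1 by rewrite eq_sym.
have G (i i' : 'I_3) : i != i' -> exists k : nat,
  (\sum_(j <- [:: o0; o1; o2]) \sum_(j' <- [:: o0; o1; o2] | j != j')
   (W1 i' i j + W2 j' i j + W1 i i' j' + W2 j i' j' + VU i j' + UV i' j + VV j j')
   = 2 * k)%N.
  move=> ni.
  have [k1 e1] := E _ _ _ _ ni n01.
  have [k2 e2] := E _ _ _ _ ni n02.
  have [k3 e3] := E _ _ _ _ ni n12.
  have [k4 e4] := E _ _ _ _ ni n10.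
  have [k5 e5] := E _ _ _ _ ni n20.
  have [k6 e6] := E _ _ _ _ ni n21.
  (* [UU i i'] occurs in all six relations and is dropped from the sum, which lowers its half by
     [3 * UU i i']. *)
  exists (k1 + k2 + k3 + k4 + k5 + k6 - 3 * UU i i')%N.
  rewrite !big_cons !big_nil !eqxx n01 n02 n12 n10 n20 n21 /=.
  clear - e1 e2 e3 e4 e5 e6; lia.
have [k1 e1] := G _ _ n01; have [k2 e2] := G _ _ n02; have [k3 e3] := G _ _ n12.
have := N o0 o0; have := N o0 o1; have := N o0 o2.
have := N o1 o0; have := N o1 o1; have := N o1 o2.
have := N o2 o0; have := N o2 o1; have := N o2 o2.
move: e1 e2 e3; rewrite !big_cons !big_nil !eqxx n01 n02 n12 n10 n20 n21 /=.
clear - s01 s02 s12; lia.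
Qed.

End Parity.

(** * Chains in connected sets *)

Section Chains.
Variable R : realType.
Implicit Types (x y z p : R * R) (A B D : set (R * R)).

Definition chained (eta : R) A x y := exists s : seq (R * R),
  [/\ path (close_pt eta) x s, last x s = y & forall z, z \in x :: s -> A z].

Lemma close_ptE eta x y : close_pt eta x y <-> ball x eta y.
Proof.
by split => [/andP[h1 h2]|[h1 h2]]; [split|apply/andP; split].
Qed.

Lemma chained_refl eta A x : A x -> chained eta A x x.
Proof. by move=> Ax; exists [::]; split => // z; rewrite inE => /eqP ->. Qed.

Lemma chained_trans eta A y x z :
  chained eta A x y -> chained eta A y z -> chained eta A x z.
Proof.
move=> [s [ps ls As]] [t [pt lt At]]; exists (s ++ t); split.
- by rewrite cat_path ps ls.
- by rewrite last_cat ls.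
- move=> u; rewrite -cat_cons mem_cat => /orP[|ut]; first exact: As.
  by apply: At; rewrite inE ut orbT.
Qed.

Lemma chained_step eta A x y : A x -> A y -> close_pt eta x y -> chained eta A x y.
Proof.
move=> Ax Ay cxy; exists [:: y]; split => //=; first by rewrite cxy.
by move=> z; rewrite !inE => /orP[/eqP ->|/eqP ->].
Qed.

Lemma chained_sub eta A B x y : A `<=` B -> chained eta A x y -> chained eta B x y.
Proof. by move=> AB [s [ps ls As]]; exists s; split => // z /As /AB. Qed.

(** The reachable points form a relatively clopen subset of [A]: within distance [eta] of a
    reachable point all points of [A] are reachable, and near an unreachable one none is. *)
Lemma connected_chained eta A x y : 0 < eta -> connected A -> A x -> A y ->
  chained eta A x y.
Proof.
move=> eta0 cA Ax Ay.
pose B := [set z | A z /\ chained eta A x z].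
suff AB : A = B by move: Ay; rewrite {1}AB => -[].
apply/esym/cA.
- by exists x; split => //; exact: chained_refl.
- exists (\bigcup_(z in B) ball z eta).
    by apply: bigcup_open => z _; exact: ball_open.
  apply/seteqP; split => [z Bz|z [Az [u [Au cu] uz]]].
    by split; [case: Bz|exists z => //; exact: ballxx].
  by split => //; apply: chained_trans cu (chained_step _ _ _) => //; apply/close_ptE.
- exists (~` \bigcup_(z in A `\` B) ball z eta).
    by apply: open_closedC; apply: bigcup_open => z _; exact: ball_open.
  apply/seteqP; split => [z Bz|z [Az nz]].
    split; [by case: Bz|move=> [u [Au nBu] uz]; apply: nBu; split => //].
    case: Bz => Az cz; apply: chained_trans cz (chained_step _ _ _) => //.
    by rewrite close_pt_sym; apply/close_ptE.
  by apply: contrapT => nBz; apply: nz; exists z => //; exact: ballxx.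
Qed.

Definition segment x y : set (R * R) :=
  [set ((1 - t) * x.1 + t * y.1, (1 - t) * x.2 + t * y.2) | t in `[0, 1]].

Lemma segment_l x y : segment x y x.
Proof.
exists 0; first by rewrite /= in_itv /= lexx ler01.
by case: x => a b /=; rewrite subr0 !mul1r !mul0r !addr0.
Qed.

Lemma segment_r x y : segment x y y.
Proof.
exists 1; first by rewrite /= in_itv /= lexx ler01.
by case: y => a b /=; rewrite subrr !mul1r !mul0r !add0r.
Qed.

Lemma affine_continuous (a b : R) : continuous (fun t : R => (1 - t) * a + t * b).
Proof.
move=> t; apply: cvgD; apply: cvgM; try exact: cvg_cst; last exact: cvg_id.
by apply: cvgB; [exact: cvg_cst|exact: cvg_id].
Qed.

Lemma connected_segment x y : connected (segment x y).
Proof.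
apply: connected_continuous_connected; first exact: segment_connected.
apply: continuous_subspaceT => t.
exact: (cvg_pair (@affine_continuous x.1 y.1 t) (@affine_continuous x.2 y.2 t)).
Qed.

Lemma segment_ball x y e : ball x e y -> segment x y `<=` ball x e.
Proof.
move=> [h1 h2] z [t]; rewrite /= in_itv /= => /andP[t0 t1] <-.
have H (a b : R) : `|a - b| < e -> `|a - ((1 - t) * a + t * b)| < e.
  move=> h; have -> : a - ((1 - t) * a + t * b) = t * (a - b) by lra.
  rewrite normrM (ger0_norm t0); apply: le_lt_trans h.
  by rewrite ler_piMl.
by split; apply: H.
Qed.

(** The distance attains its minimum on the compact product, and disjointness makes this minimum
    positive. *)
Lemma compact_separated A B : compact A -> compact B -> A `&` B = set0 ->
  exists2 e : R, 0 < e & forall a b, A a -> B b -> far_pt e a b.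
Proof.
move=> cA cB AB0.
have farE e a b : far_pt e a b = (e <= `|a - b|).
  by rewrite /far_pt prod_normE le_max.
have [AB|/set0P[p0 ABp]] := eqVneq (A `*` B) set0.
  exists 1 => // a b Aa Bb; exfalso.
  have : (A `*` B) (a, b) by [].
  by rewrite AB.
have ct : {within A `*` B, continuous (fun p : (R * R) * (R * R) => `|p.1 - p.2|)}.
  apply: continuous_subspaceT => p.
  by apply: cvg_norm; apply: cvgB; [exact: cvg_fst|exact: cvg_snd].
have [[a b] abin mn] := compact_EVT_min (ex_intro _ p0 ABp) (compact_setX cA cB) ct.
move: abin; rewrite inE => -[/= Aa Bb].
exists `|a - b|.
  rewrite normr_gt0 subr_eq0; apply/eqP => eab.
  have : (A `&` B) a by split => //; rewrite eab.
  by rewrite AB0.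
by move=> a' b' Aa' Bb'; rewrite farE; apply: (mn (a', b')); rewrite inE.
Qed.

(* Chains inside a component of the complement of the closed set D can be kept
   at a distance from D that does not depend on the mesh. *)
Lemma component_chained D p x : closed D -> connected_component (~` D) p x ->
  exists2 e : R, 0 < e & forall eta, 0 < eta ->
    chained eta [set z | forall d, D d -> far_pt e z d] p x.
Proof.
move=> cD; have [Dp|nDp] := pselect ((~` D) p); last first.
  by rewrite connected_component_out.
have avoid z : (~` D) z -> exists2 e : R, 0 < e &
    forall y, ball z e y -> forall d, D d -> far_pt e y d.
  move=> nDz; have /nbhs_ballP[r /= r0 rD] : nbhs z (~` D).
    by apply: open_nbhs_nbhs; split => //; exact: closed_openC.
  exists (r / 2); first by rewrite divr_gt0.
  move=> y zy d Dd; apply: contrapT => /negP; rewrite /far_pt negb_or -!ltNge => yd.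
  apply: (rD d) Dd; have -> : r = r / 2 + r / 2 by lra.
  by apply: ball_triangle zy _; apply/close_ptE.
pose A e := [set z | forall d, D d -> far_pt e z d].
have A_sub e e' : e' <= e -> A e `<=` A e'.
  move=> le z Az d /Az /orP[h|h]; apply/orP; [left|right]; exact: le_trans h.
(* The distance [e] may depend on the end point but not on [eta]. [W] is relatively clopen in the
   component, since a move inside a small ball only replaces [e] by a minimum of two positive
   numbers. *)
pose W := [set x | exists2 e : R, 0 < e & forall eta, 0 < eta -> chained eta (A e) p x].
have Wstep z y : (~` D) z -> (exists2 e, 0 < e & ball z e y /\ (forall y', ball z e y' -> A e y')) -> (W z <-> W y).
  move=> nDz [e e0 [zy eA]].
  have seg eta : 0 < eta -> chained eta (A e) z y.
    move=> eta0; apply: (@chained_sub _ (segment z y)).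
      by move=> u /(segment_ball zy) /eA.
    by apply: connected_chained => //; [exact: connected_segment|exact: segment_l|exact: segment_r].
  have seg' eta : 0 < eta -> chained eta (A e) y z.
    move=> eta0; apply: (@chained_sub _ (segment z y)).
      by move=> u /(segment_ball zy) /eA.
    by apply: connected_chained => //; [exact: connected_segment|exact: segment_r|exact: segment_l].
  split => -[e' e'0 ch]; exists (Num.min e e') => [|eta eta0]; rewrite ?lt_min ?e0 //.
    by apply: (chained_trans (y := z)); [apply: chained_sub (ch _ eta0)|
       apply: chained_sub (seg _ eta0)]; apply: A_sub; rewrite ge_min lexx ?orbT.
  by apply: (chained_trans (y := y)); [apply: chained_sub (ch _ eta0)|
     apply: chained_sub (seg' _ eta0)]; apply: A_sub; rewrite ge_min lexx ?orbT.
have Wopen z : (~` D) z ->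
    exists2 e : R, 0 < e & forall y, ball z e y -> (~` D) y /\ (W z <-> W y).
  move=> nDz; have [e e0 eA] := avoid _ nDz; exists e => // y zy; split.
    by move=> /(eA _ zy); rewrite /far_pt !subrr normr0 orbb leNgt e0.
  by apply: Wstep => //; exists e.
pose F := connected_component (~` D) p.
move=> Fx; suff: W x by [].
have WF : F `&` W = F.
  apply: (@component_connected _ (~` D) p).
  - exists p; split; first exact: connected_component_refl.
    have [e e0 eA] := avoid _ Dp; exists e => // eta eta0.
    by apply: chained_refl; apply: eA; exact: ballxx.
  - exists ((~` D) `&` W); last first.
      apply/seteqP; split => [z [Fz Wz]|z [Fz [_ Wz]]] //.
      by split => //; split => //; exact: connected_component_sub Fz.
    rewrite openE => z [nDz Wz]; have [e e0 eW] := Wopen _ nDz.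
    by apply/nbhs_ballP; exists e => // y /eW[nDy [Wy _]]; split => //; exact: Wy.
  - exists (~` ((~` D) `&` ~` W)); last first.
      apply/seteqP; split => [z [Fz Wz]|z [Fz nz]].
        by split => // -[].
      split => //; apply: contrapT => nW; apply: nz; split => //.
      exact: connected_component_sub Fz.
    apply: open_closedC; rewrite openE => z [nDz Wz]; have [e e0 eW] := Wopen _ nDz.
    by apply/nbhs_ballP; exists e => // y /eW[nDy [_ Wy]]; split => // /Wy.
by have : F x by []; rewrite -WF => -[].
Qed.

End Chains.

(** * Outerplanar graphs contain no K_{2,3} *)

Section Drawings.
Variable R : realType.

Lemma arc_compact (A : set (R * R)) p q : is_arc A p q -> compact A.
Proof.
by move=> [g [cg _ _ _ ->]]; apply: continuous_compact cg _; exact: segment_compact.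
Qed.

Lemma arc_connected (A : set (R * R)) p q : is_arc A p q -> connected A.
Proof.
move=> [g [cg _ _ _ ->]].
exact: connected_continuous_connected (@segment_connected _ _ _) cg.
Qed.

Lemma arc_l (A : set (R * R)) p q : is_arc A p q -> A p.
Proof.
by move=> [g [_ _ <- _ ->]]; exists 0 => //; rewrite /= in_itv /= lexx ler01.
Qed.

Lemma arc_r (A : set (R * R)) p q : is_arc A p q -> A q.
Proof.
by move=> [g [_ _ _ <- ->]]; exists 1 => //; rewrite /= in_itv /= lexx ler01.
Qed.

(** A finite minimum, started at 1 so that it is positive even for an empty index type. *)
Lemma uniform_positive (T : finType) (P : T -> R -> Prop) :
  (forall i e e', e' <= e -> P i e -> P i e') ->
  (forall i, exists2 e, 0 < e & P i e) -> exists2 e, 0 < e & forall i, P i e.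
Proof.
move=> mono ex.
have /choice[f fP] i : exists e, 0 < e /\ P i e by have [e] := ex i; exists e.
exists (\big[Num.min/1]_i f i).
  by apply: lt_bigmin => // i _; have [] := fP i.
by move=> i; apply: mono (fP i).2; exact: bigmin_le_cond.
Qed.

Lemma far_pt_le (e e' : R) x y : e' <= e -> far_pt e x y -> far_pt e' x y.
Proof. by move=> h /orP[k|k]; apply/orP; [left|right]; exact: le_trans k. Qed.

Variables (n : nat) (G : sgraph n).
Variables (pos : 'I_n -> R * R) (edge : 'I_n -> 'I_n -> set (R * R)).
Hypothesis draw : is_plane_drawing G pos edge.

Let D := drawing_support G pos edge.

Lemma drawing_closed : closed D.
Proof.
have -> : D = \bigcup_(v in [set: 'I_n]) [set pos v] `|`
    \bigcup_(e in [set e : 'I_n * 'I_n | G e.1 e.2]) edge e.1 e.2.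
  apply/seteqP; split => z [].
  - by move=> [v _ <-]; left; exists v.
  - by move=> [u [v [Guv z_uv]]]; right; exists (u, v).
  - by move=> [v _ ->]; left; exists v.
  - by move=> [[u v] Guv z_uv]; right; exists u, v.
apply: closedU; apply: closed_bigcup; try exact: finite_finset.
- by move=> v _; apply: compact_closed; [exact: norm_hausdorff|exact: compact_set1].
- move=> [u v] /= Guv; apply: compact_closed; first exact: norm_hausdorff.
  exact: arc_compact (edge_arc draw Guv).
Qed.

(** A common point of two such arcs would be a vertex by [edge_cross], hence an end of both edges by
    [edge_vertex]. So the arcs are disjoint compact sets, and there are finitely many pairs. *)
Lemma edges_separated : exists2 e : R, 0 < e & forall u v x y z z',
  G u v -> G x y -> u \notin [:: x; y] -> v \notin [:: x; y] ->
  edge u v z -> edge x y z' -> far_pt e z z'.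
Proof.
pose P (t : ('I_n * 'I_n) * ('I_n * 'I_n)) (e : R) :=
  let: ((u, v), (x, y)) := t in forall z z', 
  G u v -> G x y -> u \notin [:: x; y] -> v \notin [:: x; y] ->
  edge u v z -> edge x y z' -> far_pt e z z'.
have [|[[u v] [x y]]|e e0 eP] := @uniform_positive _ P.
- move=> [[u v] [x y]] e e' le h z z' *.
  by apply: far_pt_le le _; exact: h.
- have [[Guv Gxy nu nv]|h] := pselect [/\ G u v, G x y, u \notin [:: x; y] & v \notin [:: x; y]];
    last by exists 1 => // z z' *; case: h.
  have [|e e0 sep] := compact_separated (arc_compact (edge_arc draw Guv)) (arc_compact (edge_arc draw Gxy)).
    apply/seteqP; split => // z [zuv zxy].
    have [w _ wz] : range pos z.
      apply: (edge_cross draw Guv Gxy) => //; apply/eqP => -[eu ev];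
      by move: nu; rewrite eu !inE eqxx ?orbT.
    move: zuv zxy; rewrite -wz => /(edge_vertex draw Guv) wuv /(edge_vertex draw Gxy) wxy.
    case: wuv wxy => -> [] E; first [move: nu; rewrite E !inE eqxx ?orbT // | move: nv; rewrite E !inE eqxx ?orbT //].
  by exists e => // z z' _ _ _ _; exact: sep.
- by exists e => // u v x y z z'; exact: (eP ((u, v), (x, y))).
Qed.

Lemma vertex_edge_separated : exists2 e : R, 0 < e & forall w u v z,
  G u v -> w \notin [:: u; v] -> edge u v z -> far_pt e (pos w) z.
Proof.
pose P (t : 'I_n * 'I_n * 'I_n) (e : R) :=
  let: (w, u, v) := t in forall z,
  G u v -> w \notin [:: u; v] -> edge u v z -> far_pt e (pos w) z.
have [|[[w u] v]|e e0 eP] := @uniform_positive _ P.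
- move=> [[w u] v] e e' le h z *.
  by apply: far_pt_le le _; exact: h.
- have [[Guv nw]|h] := pselect (G u v /\ w \notin [:: u; v]);
    last by exists 1 => // z *; case: h.
  have [|e e0 sep] := compact_separated (@compact_set1 _ (pos w)) (arc_compact (edge_arc draw Guv)).
    apply/seteqP; split => // z [->] /(edge_vertex draw Guv) [] E; move: nw; rewrite E !inE eqxx ?orbT //.
  by exists e => // z _ _; exact: sep.
- by exists e => // w u v z; exact: (eP (w, u, v)).
Qed.

Lemma walk_chained eta c x p : 0 < eta -> path G c (x :: p) ->
  chained eta [set z | exists u v, [/\ G u v, u \in [:: c, x & p], v \in [:: c, x & p] & edge u v z]]
    (pos c) (pos (last x p)).
Proof.
move=> eta0; elim: p c x => [|y p IH] c x /=; rewrite -/path.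
  rewrite andbT => Gcx; have arc := edge_arc draw Gcx.
  apply: (chained_sub (A := edge c x)).
    by move=> z zcx; exists c, x; rewrite !inE !eqxx orbT.
  by apply: connected_chained => //; [exact: arc_connected arc|exact: arc_l arc|exact: arc_r arc].
move=> /andP[Gcx pth]; have arc := edge_arc draw Gcx.
apply: (chained_trans (y := pos x)).
  apply: (chained_sub (A := edge c x)).
    by move=> z zcx; exists c, x; rewrite !inE !eqxx !orbT.
  by apply: connected_chained => //; [exact: arc_connected arc|exact: arc_l arc|exact: arc_r arc].
apply: chained_sub (IH x y pth) => z [u [v [Guv ui vi zuv]]].
by exists u, v; split => //; rewrite inE ?ui ?vi orbT.
Qed.

End Drawings.

(* Otherwise, a point of the face F adjacent to all the vertices would turn the
   three walks and the three edges at q into a drawing of K_{3,3} in which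
   independent edges are disjoint. *)
Lemma outerplanar_no_K23 (R : realType) (n : nat) (G : sgraph n)
    (c q : 'I_n) (a : 'I_3 -> 'I_n) (p : 'I_3 -> seq 'I_n) :
  outerplanar R G ->
  (forall j, G q (a j)) -> (forall j, path G c (p j)) ->
  (forall j, last c (p j) = a j) -> (forall j, q \notin c :: p j) ->
  (forall j j', j != j' -> a j' \notin c :: p j) -> False.
Proof.
move=> [pos [edge [draw [F [[f0 nDf0 FE] _ cloF]]]]] Gqa Gp lp nq na.
set D := drawing_support G pos edge in nDf0 FE.
have [dE dE0 sepE] := edges_separated draw.
have [dV dV0 sepV] := vertex_edge_separated draw.
have dV20 : 0 < dV / 2 by rewrite divr_gt0.
(* The face reaches every vertex only in its closure, so its chains stop at a point [f j] near [a j]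
   and a short segment completes them. *)
have near_a j : exists f, F f /\ ball (pos (a j)) (dV / 2) f.
  have [f [Ff bf]] := cloF (a j) _ (nbhsx_ballx (pos (a j)) (dV / 2) dV20).
  by exists f.
have [f fP] := choice near_a.
have [|j|dF dF0 chF] := @uniform_positive R _ (fun j e => forall eta, 0 < eta ->
    chained eta [set z | forall d, D d -> far_pt e z d] f0 (f j)).
- move=> j e e' le h eta eta0; apply: chained_sub (h eta eta0) => z zD d Dd.
  by apply: far_pt_le le _; exact: zD.
- apply: component_chained; first exact: drawing_closed draw.
  by rewrite -FE; have [] := fP j.
pose delta := Num.min dE (Num.min (dV / 2) dF).
have delta0 : 0 < delta by rewrite !lt_min dE0 dF0 dV20.
have leE : delta <= dE by rewrite ge_min lexx.
have leV : delta <= dV / 2 by rewrite !ge_min lexx orbT.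
have leF : delta <= dF by rewrite !ge_min lexx !orbT.
pose eta := delta / 2; have eta0 : 0 < eta by rewrite divr_gt0.
(* [Z i j] confines the chain to [a j] from the vertex of [K_{3,3}] numbered [i] among [c], [q] and
   [f0]. A chain from [f0] stays [dF] away from the drawing up to [f j], then inside a small ball
   around [a j]. *)
pose Z (i j : 'I_3) : set (R * R) := match val i with
  | 0%N => [set z | exists u v, [/\ G u v, u \in c :: p j, v \in c :: p j & edge u v z]]
  | 1%N => edge q (a j)
  | _ => [set z | (forall d, D d -> far_pt dF z d) \/ ball (pos (a j)) (dV / 2) z]
  end.
pose o (i : 'I_3) := match val i with 0%N => pos c | 1%N => pos q | _ => f0 end.
have Zch i j : chained eta (Z i j) (o i) (pos (a j)).
  case: i => [[|[|[|//]]] hi]; rewrite /Z /o /=.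
  (* An empty walk would give [a j = c], a vertex of the other walks. *)
  - have : p j != [::].
      apply/eqP => pj; pose j' : 'I_3 := if j == ord0 then ord_max else ord0.
      have jj' : j' != j by rewrite /j'; case: (eqVneq j ord0) => [->|nj0] //; rewrite eq_sym.
      by have := na _ _ jj'; rewrite -(lp j) pj mem_head.
    have := Gp j; have := lp j; case: (p j) => // x p' /= <- pth _.
    exact: (walk_chained draw).
  - have arc := edge_arc draw (Gqa j).
    by apply: connected_chained => //; [exact: arc_connected arc|exact: arc_l arc|exact: arc_r arc].
  - apply: (chained_trans (y := f j)).
      by apply: chained_sub (chF j eta eta0) => z; left.
    have [_ bf] := fP j.
    apply: (chained_sub (A := segment (pos (a j)) (f j))).
      by move=> z /(segment_ball bf); right.
    by apply: connected_chained => //; [exact: connected_segment|exact: segment_r|exact: segment_l].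
(* The ball has radius [dV / 2], while [pos (a j)] is [dV] away from the edges that do not end
   there. *)
have near_far j u v z z' : G u v -> a j \notin [:: u; v] -> edge u v z ->
    Z ord_max j z' -> far_pt delta z z'.
  move=> Guv naj zuv [zF|zb]; rewrite far_pt_sym.
    by apply: far_pt_le leF _; apply: zF; right; exists u, v.
  have := sepV _ _ _ _ Guv naj zuv.
  apply: contraTT => nf; rewrite /far_pt negb_or -!ltNge.
  suff : ball (pos (a j)) dV z by case=> h1 h2; apply/andP; split.
  have -> : dV = dV / 2 + dV / 2 by lra.
  apply: ball_triangle zb _; move: nf; rewrite /far_pt negb_or -!ltNge => /andP[h1 h2].
  by split; [exact: lt_le_trans h1 _|exact: lt_le_trans h2 _].
have Zfar (i i' j j' : 'I_3) (z z' : R * R) : (val i < val i')%N -> j != j' -> Z i j z -> Z i' j' z' -> far_pt delta z z'.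
  case: i i' => [[|[|[|//]]] hi] [[|[|[|//]]] hi'] //= _ jj'; rewrite {1}/Z /=.
  - move=> [u [v [Guv ui vi zuv]]] z'E; apply: far_pt_le leE _.
    apply: (sepE _ _ _ _ _ _ Guv (Gqa j')) zuv z'E.
      by rewrite !inE negb_or; apply/andP; split; apply: contraTneq ui => ->; [exact: nq|exact: na].
    by rewrite !inE negb_or; apply/andP; split; apply: contraTneq vi => ->; [exact: nq|exact: na].
  - move=> [u [v [Guv ui vi zuv]]] z'Z; apply: (near_far j') Guv _ zuv z'Z.
    by rewrite !inE negb_or; apply/andP; split; [apply: contraTneq ui => <-|apply: contraTneq vi => <-]; exact: na.
  - move=> zE z'Z; apply: (near_far j') (Gqa j) _ zE z'Z.
    rewrite !inE negb_or; apply/andP; split.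
      by apply: contraNneq (nq j') => <-; rewrite -(lp j') mem_last.
    by apply: contraNneq (na _ _ jj') => ->; rewrite -(lp j) mem_last.
have /choice[s' sP] (t : 'I_3 * 'I_3) := Zch t.1 t.2.
apply: (@K33_crosses R delta eta eta0 _ o (fun j => pos (a j)) (fun i j => s' (i, j))).
- by rewrite /eta; lra.
- by move=> i j; have [] := sP (i, j).
- by move=> i j; have [] := sP (i, j).
- move=> i i' j j' ii' jj'; apply/allrelP => z z' zs zs'.
  have [_ _ /(_ _ zs) Zz] := sP (i, j); have [_ _ /(_ _ zs') Zz'] := sP (i', j').
  case: (ltngtP (val i) (val i')) => [lt|lt|/val_inj eq].
  + exact: Zfar lt jj' Zz Zz'.
  + by rewrite far_pt_sym; apply: Zfar lt _ Zz' Zz; rewrite eq_sym.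
  + by rewrite eq eqxx in ii'.
Qed.

(** * Codegrees and number of edges *)

Lemma sum_nat_of_bool (T : finType) (P : pred T) :
  (\sum_x (P x : nat) = #|[pred x | P x]|)%N.
Proof.
by rewrite -sum1_card [RHS]big_mkcond; apply: eq_bigr => x _; rewrite inE; case: (P x). Qed.

Section Sparsity.
Variables (R : realType) (n : nat) (G : sgraph n).
Hypothesis outerG : outerplanar R G.

Lemma card_neighbors_reached (c q : 'I_n) (A : {pred 'I_n}) :
  {in A, forall x, G q x} ->
  {in A, forall x, exists p, [/\ path G c p, last c p = x, q \notin c :: p &
    {in A, forall y, y != x -> y \notin c :: p}]} ->
  (#|A| <= 2)%N.
Proof.
move=> Aq Ap; rewrite leqNgt; apply/negP => A3.
pose a (j : 'I_3) : 'I_n := enum_val (widen_ord A3 j).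
have aA j : a j \in A by exact: enum_valP.
have a_inj : injective a by move=> i j /enum_val_inj/(congr1 val) /= /val_inj.
have /choice[p pP] j := Ap _ (aA j).
apply: (@outerplanar_no_K23 R n G c q a p outerG).
- by move=> j; exact: Aq.
- by move=> j; have [] := pP j.
- by move=> j; have [] := pP j.
- by move=> j; have [] := pP j.
- move=> j j' jj'; have [_ _ _] := pP j; apply => //.
  by rewrite (inj_eq a_inj) eq_sym.
Qed.

(** The walks are single steps from [v] to the common neighbours. *)
Lemma codegree_le2 (u v : 'I_n) : u != v -> (\sum_k (G u k && G v k) <= 2)%N.
Proof.
move=> uv; rewrite sum_nat_of_bool.
apply: (@card_neighbors_reached v u) => x; rewrite unfold_in => /andP[ux vx] //.
exists [:: x]; split => //=; first by rewrite vx.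
  rewrite !inE negb_or uv; apply: contraTneq ux => ->; by rewrite adj_irrefl.
move=> y; rewrite unfold_in => /andP[uy vy] yx; rewrite !inE negb_or yx andbT.
by apply: contraTneq vy => ->; rewrite adj_irrefl.
Qed.

(** [lvl] is the distance from [r]. A proper prefix of a shortest walk is shorter, so its end has a
    smaller level. *)
Lemma exists_levels (r : 'I_n) : sgraph_connected G ->
  exists lvl : 'I_n -> nat, (forall x y, G x y -> (lvl y <= (lvl x).+1)%N) /\
    forall x, exists p, [/\ path G r p, last r p = x &
      forall y, y \in r :: p -> y = x \/ (lvl y < lvl x)%N].
Proof.
move=> conn.
pose P x k := [exists t : k.-tuple 'I_n, path G r t && (last r t == x)].
have exP x : exists k, P x k.
  have /connectP[p pth ->] := conn r x.
  by exists (size p); apply/existsP; exists (in_tuple p); rewrite pth eqxx.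
have PP x p : path G r p -> last r p = x -> P x (size p).
  by move=> pth <-; apply/existsP; exists (in_tuple p); rewrite pth eqxx.
pose lvl x := ex_minn (exP x).
have lvlP x : exists p, [/\ path G r p, last r p = x & size p = lvl x].
  rewrite /lvl; case: ex_minnP => m /existsP[t /andP[pt /eqP lt]] _.
  by exists t; rewrite size_tuple.
have lvl_le x p : path G r p -> last r p = x -> (lvl x <= size p)%N.
  by move=> pth lp; rewrite /lvl; case: ex_minnP => m _; apply; exact: PP.
exists lvl; split => [x y Gxy|x].
  have [p [pth lp <-]] := lvlP x.
  rewrite -(size_rcons p y); apply: lvl_le; last by rewrite last_rcons.
  by rewrite rcons_path pth lp.
have [p [pth lp sp]] := lvlP x; exists p; split => // y yp.
move: pth lp sp; case/splitPl: yp => p1 [|z p2] ly pth lp sp; first by left; rewrite -ly -lp cats0.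
right; rewrite -sp size_cat /= addnS ltnS; apply: leq_trans (leq_addr _ _).
by apply: lvl_le => //; move: pth; rewrite cat_path => /andP[].
Qed.

(* Three neighbours of u on one level not above u are reached from the root by
   walks through lower levels, so u has at most two neighbours on such a level. *)
Lemma sum_degree_le : sgraph_connected G ->
  (\sum_u \sum_v G u v <= 8 * n)%N.
Proof.
move=> conn; case: (posnP n) => [n0|n_gt0].
  by rewrite big1 // => -[i hi] _; exfalso; rewrite n0 in hi.
have [lvl [lvl_adj lvl_walk]] := exists_levels (Ordinal n_gt0) conn.
have same u L : (L <= lvl u)%N -> (\sum_v (G u v && (lvl v == L)) <= 2)%N.
  move=> Lu; rewrite sum_nat_of_bool.
  apply: (@card_neighbors_reached (Ordinal n_gt0) u) => x.
    by rewrite unfold_in => /andP[].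
  rewrite unfold_in => /andP[ux /eqP xL]; have [p [pth lp pl]] := lvl_walk x.
  exists p; split => //.
    apply/negP => /pl[eux|]; last by rewrite xL ltnNge Lu.
    by move: ux; rewrite eux adj_irrefl.
  move=> y; rewrite unfold_in => /andP[_ /eqP yL] yx; apply/negP => /pl[/eqP|].
    by rewrite (negPf yx).
  by rewrite xL yL ltnn.
(* Adjacent levels differ by at most 1, so these neighbours lie on the level of [u] or the one
   before it, at most two on each. *)
have below u : (\sum_v (G u v && (lvl v <= lvl u)) <= 4)%N.
  apply: leq_trans (leq_add (same u (lvl u) (leqnn _)) (same u (lvl u).-1 (leq_pred _))).
  rewrite -big_split /=; apply: leq_sum => v _.
  case uv: (G u v) => //=; have := lvl_adj v u; rewrite adj_sym uv => /(_ isT).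
  by case: leqP => //; lia.
(* Each adjacent pair is charged to an end of larger or equal level; exchanging the sums shows both
   halves equal, each at most [4 * n]. *)
apply: (@leq_trans (\sum_u (\sum_v (G u v && (lvl v <= lvl u)) +
    \sum_v (G v u && (lvl u <= lvl v))))).
  apply: leq_sum => u _; rewrite -big_split /=; apply: leq_sum => v _.
  by rewrite (adj_sym G v u); case: (G u v) => //=; lia.
rewrite big_split /= [X in (_ + X <= _)%N]exchange_big /= addnn -mul2n.
rewrite (_ : 8 * n = 2 * (\sum_(u < n) 4))%N; last by rewrite sum_nat_const card_ord; lia.
by rewrite leq_mul2l /=; apply: leq_sum => u _; exact: below.
Qed.

End Sparsity.

(** * A drawing of the fan *)

Section FanDrawing.
Variable R : realType.

Definition axis_point (k : nat) : R * R := (k%:R, 0).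

Definition bump (m M : nat) (x : R) : R := if m == 0%N then x * (M%:R - x) else 0.

(* Vertices lie on the x-axis; an edge at the hub 0 is a parabolic arc, any other
   edge is a segment of the axis, and the face containing the lower half-plane
   touches all the vertices. *)
Definition fan_curve (m M : nat) : set (R * R) :=
  [set z | m%:R <= z.1 <= M%:R /\ z.2 = bump m M z.1].

Definition fan_pair (m M : nat) := (m < M)%N && ((m == 0%N) || (M == m.+1)).

Lemma axis_point_inj : injective axis_point.
Proof. by move=> i j [/eqP]; rewrite eqr_nat => /eqP. Qed.

Lemma bump_ge0 m M x : m%:R <= x <= M%:R -> 0 <= bump m M x.
Proof.
rewrite /bump => /andP[mx xM]; case: eqP => // m0.
by rewrite mulr_ge0 ?subr_ge0 //; move: mx; rewrite m0.
Qed.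

Lemma fan_curve_vertex m M k : fan_pair m M -> fan_curve m M (axis_point k) ->
  k = m \/ k = M.
Proof.
move=> /andP[mM mM'] [/= /andP[]]; rewrite !ler_nat /bump => mk kM.
case: eqP mM' => [m0 _ /esym/eqP|_ /= /eqP mM' _]; last by lia.
rewrite mulf_eq0 subr_eq0 !eqr_nat -[0]/(0%:R) eqr_nat => /orP[]/eqP; lia.
Qed.

Lemma fan_curve_cross m M m' M' z : fan_pair m M -> fan_pair m' M' ->
  (m, M) <> (m', M') -> fan_curve m M z -> fan_curve m' M' z ->
  z = axis_point m \/ z = axis_point M.
Proof.
move=> mM mM' ne zC zC'.
(* By [fan_curve_vertex] a common point of the form [axis_point k] is an end. Two parabolas meet
   only at the origin, a parabola meets the axis only at its two zeros, and two unit segments of the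
   axis share at most an end. *)
suff [k zk] : exists k, z = axis_point k.
  by move: zC; rewrite zk => /(fan_curve_vertex mM)[] ->; [left|right].
move: mM mM' zC zC' ne; rewrite /fan_curve /bump /=.
move=> /andP[mM mM1] /andP[mM' mM1'].
case: z => x y /= [/andP[mx xM] yE] [/andP[mx' xM'] yE'] ne.
have [m0|m0] := eqVneq m 0%N; have [m0'|m0'] := eqVneq m' 0%N;
  rewrite ?m0 ?m0' ?(negPf m0) ?(negPf m0') ?eqxx in yE yE' mM1 mM1'.
- exists 0%N; suff x0 : x = 0 by rewrite /axis_point yE x0 mul0r.
  have : x * (M%:R - M'%:R) = 0 by lra.
  move/eqP; rewrite mulf_eq0 subr_eq0 eqr_nat => /orP[/eqP //|/eqP MM].
  by case: ne; rewrite m0 m0' MM.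
- exists M; rewrite /axis_point yE' ; congr (_, _).
  have : x * (M%:R - x) = 0 by lra.
  move/eqP; rewrite mulf_eq0 subr_eq0 => /orP[/eqP x0|/eqP //].
  by move: mx'; rewrite x0 -[0]/(0%:R) ler_nat; lia.
- exists M'; rewrite /axis_point yE ; congr (_, _).
  have : x * (M'%:R - x) = 0 by lra.
  move/eqP; rewrite mulf_eq0 subr_eq0 => /orP[/eqP x0|/eqP //].
  by move: mx; rewrite x0 -[0]/(0%:R) ler_nat; lia.
- move: mM1 mM1' => /eqP mM1 /eqP mM1'; subst M M'.
  have mm' : m <> m' by move=> E; apply: ne; rewrite E.
  have h1 : (m <= m'.+1)%N by rewrite -(ler_nat R); exact: le_trans xM'.
  have h2 : (m' <= m.+1)%N by rewrite -(ler_nat R); exact: le_trans xM.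
  case: (ltngtP m m') => // lt.
    have E : m' = m.+1 by lia.
    exists m'; rewrite /axis_point yE; congr (_, _); apply/le_anti.
    by rewrite mx' E xM.
  have E : m = m'.+1 by lia.
  exists m; rewrite /axis_point yE; congr (_, _); apply/le_anti.
  by rewrite mx E xM'.
Qed.

Lemma fan_curve_arc (u v : nat) : u != v ->
  is_arc (fan_curve (minn u v) (maxn u v)) (axis_point u) (axis_point v).
Proof.
move=> uv; set m := minn u v; set M := maxn u v.
have uvR : (v%:R - u%:R : R) != 0 by rewrite subr_eq0 eqr_nat eq_sym.
pose X (t : R) : R := (1 - t) * u%:R + t * v%:R.
have cX : continuous X by exact: affine_continuous.
have cB : continuous (bump m M).
  move=> x; rewrite /bump; case: eqP => _; last exact: cvg_cst.
  by apply: cvgM; [exact: cvg_id|apply: cvgB; [exact: cvg_cst|exact: cvg_id]].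
exists (fun t => (X t, bump m M (X t))); split.
- apply: continuous_subspaceT => t.
  exact: (cvg_pair (cX t) (continuous_comp (cX t) (cB _))).
- move=> t t' _ _ [XX _]; have : (t - t') * (v%:R - u%:R) = 0 by move: XX; rewrite /X; lra.
  by move/eqP; rewrite mulf_eq0 (negPf uvR) orbF subr_eq0 => /eqP.
- rewrite /X subr0 mul1r mul0r addr0; congr (_, _); rewrite /bump.
  case: eqP => // m0; rewrite /m /M in m0 *; case: (ltngtP u v) m0 uv => // _ m0 _;
    by rewrite ?subrr ?mulr0 // m0 ?mul0r ?subrr ?mulr0.
- rewrite /X subrr mul1r mul0r add0r; congr (_, _); rewrite /bump.
  case: eqP => // m0; rewrite /m /M in m0 *; case: (ltngtP u v) m0 uv => // _ m0 _;
    by rewrite ?subrr ?mulr0 // m0 ?mul0r ?subrr ?mulr0.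
- apply/seteqP; split => [[x y] [/= mxM yE]|z [t]].
    exists ((x - u%:R) / (v%:R - u%:R)).
      move: mxM uvR; rewrite /= in_itv /= /m /M.
      case: (ltngtP u v) uv => // lt _ /andP[h1 h2] uvR.
        have uv : (0 : R) < v%:R - u%:R by rewrite subr_gt0 ltr_nat.
        by rewrite ler_pdivlMr // ler_pdivrMr // mul0r mul1r subr_ge0 h1 lerD2r.
      have uv : v%:R - u%:R < (0 : R) by rewrite subr_lt0 ltr_nat.
      by rewrite ler_ndivlMr // ler_ndivrMr // mul0r mul1r subr_le0 h2 lerD2r.
    have -> : X ((x - u%:R) / (v%:R - u%:R)) = x by rewrite /X; field.
    by rewrite yE.
  rewrite /= in_itv /= => /andP[t0 t1] <-; split => //=.
  rewrite /X /m /M; case: (ltngtP u v) uv => // lt _; have : (u%:R : R) <= v%:R \/ (v%:R : R) <= u%:R by rewrite !ler_nat; lia.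
    have luv : (u%:R : R) <= v%:R by rewrite ler_nat ltnW.
    by move=> _; apply/andP; split; nra.
  have luv : (v%:R : R) <= u%:R by rewrite ler_nat ltnW.
  by move=> _; apply/andP; split; nra.
Qed.

Lemma fan_outerplanar (n : nat) (G : sgraph n) :
  (forall i j : 'I_n, G i j -> fan_pair (minn i j) (maxn i j)) -> outerplanar R G.
Proof.
move=> fanG.
pose pos (i : 'I_n) := axis_point i.
pose edge (i j : 'I_n) := fan_curve (minn i j) (maxn i j).
have neq i j : G i j -> (i : nat) != j.
  by apply: contraTneq => /val_inj ->; rewrite adj_irrefl.
exists pos, edge; split.
  split.
  - by move=> i j /axis_point_inj/val_inj.
  - by move=> u v _; rewrite /edge minnC maxnC.
  - by move=> u v /neq; exact: fan_curve_arc.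
  - move=> u v w /fanG fan /(fan_curve_vertex fan) h.
    have [/val_inj|/val_inj] : (w : nat) = u \/ (w : nat) = v; [|by left|by right].
    by move: h; case: (ltngtP u v) => _ [] ->; tauto.
  - move=> u v x y /fanG f1 /fanG f2 /eqP n1 /eqP n2 z [z1 z2].
    have : z = axis_point (minn u v) \/ z = axis_point (maxn u v).
      apply: fan_curve_cross f1 f2 _ z1 z2 => -[e1 e2].
      have [[/val_inj ex /val_inj ey]|[/val_inj ex /val_inj ey]] :
          (val u = x /\ val v = y) \/ (val u = y /\ val v = x) by rewrite /=; lia.
        by apply: n1; rewrite ex ey.
      by apply: n2; rewrite ex ey.
    by case: (leqP u v) => _ [] ->; [exists u|exists v|exists v|exists u].
set D := drawing_support G pos edge.
have below z : z.2 < 0 -> (~` D) z.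
  move=> z0 [[v _ vz]|[u [v [Guv [zuv zE]]]]].
    by move: z0; rewrite -vz /= ltxx.
  by move: z0; rewrite zE ltNge bump_ge0.
pose p : R * R := (0, -1).
(* The open lower half-plane is convex and avoids the drawing, so it lies in one face. *)
have Fz z : z.2 < 0 -> connected_component (~` D) p z.
  move=> z0; have sub : segment p z `<=` ~` D.
    move=> _ [t] /[swap] <- /=; rewrite in_itv /= => /andP[t0 t1]; apply: below => /=.
    have [->|tn0] := eqVneq t 0; first by lra.
    have : 0 < t by rewrite lt_neqAle eq_sym tn0.
    by nra.
  by apply: (connected_component_max (segment_l p z) sub (@connected_segment _ p z)); exact: segment_r.
exists (connected_component (~` D) p); split.
- by exists p => //; apply: below; rewrite /=; lra.
(* A point of the lower half-plane with first coordinate [|M| + 2] exceeds the supposed bound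
   [M + 1]. *)
- move=> [M [_ /(_ (M + 1))]]; rewrite ltrDl ltr01 => /(_ isT) /(_ (`|M| + 2, -1)).
  move=> /(_ (Fz _ _)) /=; have -> : (-1 < 0 :> R) by lra.
  move=> /(_ isT); rewrite prod_normE ge_max /= => /andP[+ _].
  have := ler_norm M; have := ler_norm (`|M| + 2); lra.
- move=> v B /nbhs_ballP[e /= e0 eB].
  exists (v%:R, - (e / 2)); split; first by apply: Fz; rewrite /=; lra.
  apply: eB; split; rewrite /= /ball /= ?subrr ?normr0 //.
  by rewrite opprK add0r gtr0_norm; lra.
Qed.

End FanDrawing.

(** * Eigenvalues *)

Section Eigenvalues.
Variables (R : realType) (n : nat) (G : sgraph n).

Lemma eigenvalue_adj_mx (a : R) (y : 'I_n -> R) (v : 'I_n) : y v != 0 ->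
  (forall u, \sum_k (G u k)%:R * y k = a * y u) -> eigenvalue (adj_mx R G) a.
Proof.
move=> yv Ey; apply/eigenvalueP; exists (\row_i y i).
  apply/rowP => u; rewrite !mxE -Ey; apply: eq_bigr => k _.
  by rewrite !mxE adj_sym mulrC.
by apply/eqP => /rowP/(_ v); rewrite !mxE; apply/eqP.
Qed.

Lemma eigenvalue_normalized (a : R) : eigenvalue (adj_mx R G) a ->
  exists (y : 'I_n -> R) (v : 'I_n), [/\ `|y v| = 1, forall u, `|y u| <= 1 &
    forall u, \sum_k (G u k)%:R * y k = a * y u].
Proof.
case/eigenvalueP => x Ex /eqP/rowP x0.
have [v0 xv0] : exists v, x ord0 v != 0.
  apply: contrapT => h; apply: x0 => v; rewrite mxE; apply/eqP.
  by apply: contraT => xv; case: h; exists v.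
case: (@arg_maxP _ _ _ v0 xpredT (fun v => `|x ord0 v|) isT) => v _ vmax.
have xv : 0 < `|x ord0 v| by apply: lt_le_trans (vmax v0 isT); rewrite normr_gt0.
exists (fun u => x ord0 u / `|x ord0 v|), v; split.
- by rewrite normrM normfV normr_id divff // gt_eqF.
- by move=> u; rewrite normrM normfV normr_id ler_pdivrMr // mul1r; exact: vmax.
- move=> u; rewrite mulrA; have /rowP/(_ u) := Ex; rewrite !mxE => <-.
  rewrite mulr_suml; apply: eq_bigr => k _.
  by rewrite !mxE adj_sym mulrA [X in X / _]mulrC.
Qed.

(** Bounds the set of eigenvalues, so that [sup] and [inf] are genuine bounds and not default
    values. *)
Lemma eigenvalue_norm_le (a : R) : eigenvalue (adj_mx R G) a -> `|a| <= n%:R.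
Proof.
move=> /eigenvalue_normalized[y [v [yv y1 Ey]]].
have -> : `|a| = `|a * y v| by rewrite normrM yv mulr1.
rewrite -Ey.
apply: le_trans (ler_norm_sum _ _ _) _.
apply: (@le_trans _ _ (\sum_(k < n) 1)); last by rewrite sumr_const card_ord.
apply: ler_sum => k _; rewrite normrM normr_nat.
by case: (G v k); rewrite ?mul1r ?mul0r.
Qed.

Lemma lambda_max_ge (a : R) : eigenvalue (adj_mx R G) a -> a <= lambda_max R G.
Proof.
move=> ea; apply: ub_le_sup => //; exists n%:R => b /eigenvalue_norm_le.
by rewrite ler_norml => /andP[].
Qed.

Lemma lambda_min_le (a : R) : eigenvalue (adj_mx R G) a -> lambda_min R G <= a.
Proof.
move=> ea; apply: ge_inf => //; exists (- n%:R) => b /eigenvalue_norm_le.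
by rewrite ler_norml => /andP[].
Qed.

End Eigenvalues.

(** * Eigenvalues of the comparison graph *)

Section PathTriples.
Variables (R : realType) (s n : nat).

(** The test [i %% 3 != 0] cuts the path on 1, ..., [3 * s] after each multiple of 3. *)
Definition triples_half (i j : nat) : bool :=
  (i < j)%N && ((i == 0) || [&& j == i.+1, (i %% 3 != 0) & (j <= 3 * s)])%N.

Definition triples_rel : rel 'I_n := fun i j => triples_half i j || triples_half j i.

Lemma triples_sym : symmetric triples_rel.
Proof. by move=> i j; rewrite /triples_rel orbC. Qed.

Lemma triples_irrefl : irreflexive triples_rel.
Proof. by move=> i; rewrite /triples_rel /triples_half ltnn. Qed.

(* The hub 0 joined to s disjoint paths 3k+1, 3k+2, 3k+3 and to isolated vertices. *)
Definition triples : sgraph n := SGraph triples_sym triples_irrefl.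

Lemma triples_outerplanar : outerplanar R triples.
Proof.
apply: fan_outerplanar => i j; rewrite /= /triples_rel /triples_half /fan_pair.
by case: (ltngtP i j) => //= ->; rewrite ?orbF => /orP[->|/and3P[-> _ _]]; rewrite ?orbT.
Qed.

Hypothesis s_le : (3 * s < n)%N.

Section Eigenvector.
Variable t : R.
Hypotheses (t0 : t != 0) (t2 : t ^+ 2 - 2 != 0).

(** With entry 1 at the hub, the middle entry [p] and end entry [q] of a path solve [t p = 1 + 2 q]
    and [t q = 1 + p]; middles are the indices congruent to 2 modulo 3. *)
Definition triples_vec (i : nat) : R :=
  if i == 0%N then 1 else if (i <= 3 * s)%N then
    if (i %% 3 == 2)%N then (t + 2) / (t ^+ 2 - 2) else (t + 1) / (t ^+ 2 - 2)
  else t^-1.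

Local Notation f := triples_vec.

Lemma sum_triples_vec : \sum_(1 <= i < n) f i =
  s%:R * ((3 * t + 4) / (t ^+ 2 - 2)) + (n - 1 - 3 * s)%:R * t^-1.
Proof.
rewrite (@big_cat_nat _ _ _ (3 * s).+1) //=; congr (_ + _).
- have H k : (k <= s)%N -> \sum_(1 <= i < (3 * k).+1) f i = k%:R * ((3 * t + 4) / (t ^+ 2 - 2)).
    elim: k => [|k IH] ks; first by rewrite muln0 big_geq // mul0r.
    have -> : ((3 * k.+1).+1 = (3 * k).+4)%N by lia.
    rewrite 3?big_nat_recr //= IH; last by lia.
    rewrite /f /=.
    have -> : ((3 * k).+1 <= 3 * s)%N by lia.
    have -> : ((3 * k).+2 <= 3 * s)%N by lia.
    have -> : ((3 * k).+3 <= 3 * s)%N by lia.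
    have -> : ((3 * k).+1 %% 3 == 2)%N = false by lia.
    have -> : ((3 * k).+2 %% 3 == 2)%N by lia.
    have -> : ((3 * k).+3 %% 3 == 2)%N = false by lia.
    by rewrite -natr1; field.
  exact: H.
- rewrite (eq_big_nat _ _ (F2 := fun=> t^-1)).
    by rewrite sumr_const_nat mulr_natl; congr (_ *+ _); lia.
  move=> i /andP[si _]; rewrite /f; have -> : (i == 0)%N = false by lia.
  by rewrite leqNgt si.
Qed.

Lemma sum_pick (F : nat -> R) k (b : bool) : (b -> k < n)%N ->
  \sum_(i < n) ((i == k :> nat) && b)%:R * F i = if b then F k else 0.
Proof.
case: b => [/(_ isT) kn|_]; last by rewrite big1 // => i _; rewrite andbF mul0r.
rewrite (bigD1 (Ordinal kn)) //= eqxx mul1r big1 ?addr0 // => i ik.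
by rewrite (_ : (i == k :> nat) = false) ?mul0r //; apply: contraNF ik => /eqP ik; apply/eqP/val_inj.
Qed.

Lemma triples_row (j : 'I_n) : (0 < j)%N ->
  \sum_(i < n) (triples j i)%:R * f i =
  1 + (if ((j.-1 %% 3 != 0) && (j <= 3 * s))%N then f j.-1 else 0)
    + (if ((j %% 3 != 0) && (j < 3 * s))%N then f j.+1 else 0).
Proof.
move=> j0.
have j_lt := ltn_ord j.
have E0 : \sum_(i < n) ((i == 0 :> nat) && true)%:R * f i = 1.
  by rewrite sum_pick // => _; lia.
have E1 := @sum_pick f j.-1 ((j.-1 %% 3 != 0) && (j <= 3 * s))%N.
have E2 := @sum_pick f j.+1 ((j %% 3 != 0) && (j < 3 * s))%N.
rewrite -[X in _ = X + _ + _]E0 -E1; last by lia.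
rewrite -E2; last by lia.
rewrite -!big_split /=; apply: eq_bigr => i _; rewrite -!mulrDl -!natrD.
congr (_ * _); congr (_%:R).
rewrite /triples_rel /triples_half.
case: (posnP i) => [->|i0]; first by lia.
by lia.
Qed.

(** The equations off the hub hold by the choice of [triples_vec]; the one at the hub, multiplied by
    [t * (t ^+ 2 - 2)], is the quartic. *)
Lemma triples_eigenvalue :
  t ^+ 4 - (n%:R + 1) * t ^+ 2 - 4 * s%:R * t + 2 * (n - 1 - 3 * s)%:R = 0 ->
  eigenvalue (adj_mx R triples) t.
Proof.
move=> pt; have n0 : (0 < n)%N by lia.
apply: (@eigenvalue_adj_mx _ _ _ _ (fun i => f i) (Ordinal n0)).
  by rewrite /f /= oner_neq0.
move=> j; have [j0|j0] := posnP j.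
  rewrite j0 {2}/f eqxx mulr1.
  transitivity (\sum_(1 <= i < n) f i).
    rewrite (eq_bigr (fun i : 'I_n => (0 < i)%N%:R * f i)); last first.
      by move=> i _; rewrite /= /triples_rel /triples_half j0 /= ?ltn0 ?andbT ?orbF.
    rewrite -(big_mkord xpredT (fun i => (0 < i)%N%:R * f i)) big_ltn //= mul0r add0r.
    by apply: eq_big_nat => i /andP[i0 _]; rewrite i0 mul1r.
  rewrite sum_triples_vec; apply/eqP; rewrite -subr_eq0; apply/eqP.
  have nE : n%:R = (n - 1 - 3 * s)%:R + 3 * s%:R + 1 :> R.
    by rewrite -natrM -natrD natr1; congr (_%:R); lia.
  move: pt; rewrite nE; set r := (n - 1 - 3 * s)%:R => pt.
  have -> : s%:R * ((3 * t + 4) / (t ^+ 2 - 2)) + r * t^-1 - t =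
    - (t ^+ 4 - (r + 3 * s%:R + 1 + 1) * t ^+ 2 - 4 * s%:R * t + 2 * r) / (t * (t ^+ 2 - 2)).
    by field; rewrite t0 t2.
  by rewrite pt oppr0 mul0r.
rewrite triples_row // /f; rewrite (gtn_eqF j0).
case: (leqP j (3 * s)) => js.
  rewrite andbT; have : (j %% 3 < 3)%N by rewrite ltn_mod.
  case: j j0 js => j jn /= j0 js.
  case jm : (j %% 3)%N => [|[|[|//]]] _ /=.
  - have -> : (j.-1 %% 3 != 0)%N by lia.
    have -> : (j.-1 == 0)%N = false by lia.
    have -> : (j.-1 <= 3 * s)%N by lia.
    have -> : (j.-1 %% 3 == 2)%N by lia.
    by rewrite ?jm /=; field.
  - have -> : (j.-1 %% 3 != 0)%N = false by lia.
    have -> : (j < 3 * s)%N by lia.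
    have -> : (j.+1 %% 3 == 2)%N by lia.
    by rewrite ?jm /=; field.
  - have -> : (j.-1 %% 3 != 0)%N by lia.
    have -> : (j.-1 == 0)%N = false by lia.
    have -> : (j.-1 <= 3 * s)%N by lia.
    have -> : (j.-1 %% 3 == 2)%N = false by lia.
    have -> : (j < 3 * s)%N by lia.
    have -> : (j.+1 %% 3 == 2)%N = false by lia.
    by rewrite ?jm /=; field.
have -> : (j < 3 * s)%N = false by lia.
by rewrite !andbF !addr0 divff.
Qed.

End Eigenvector.
End PathTriples.

(** * The spread of the comparison graph *)

Section TriplesSpread.
Variable R : realType.

Lemma quartic_root (b c d u v : R) : u <= v ->
  u ^+ 4 - b * u ^+ 2 - c * u + d <= 0 -> 0 <= v ^+ 4 - b * v ^+ 2 - c * v + d ->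
  exists2 t, u <= t & t ^+ 4 - b * t ^+ 2 - c * t + d = 0.
Proof.
move=> uv pu pv; pose p : {poly R} := 'X^4 - b *: 'X^2 - c *: 'X + d%:P.
have pE t : p.[t] = t ^+ 4 - b * t ^+ 2 - c * t + d by rewrite /p !hornerE.
have [|t /andP[ut _] /rootP pt] := @poly_ivt _ p u v uv; first by rewrite !pE pu pv.
by exists t; rewrite -?pE.
Qed.

(** For [sg] near [S^2] and [rho] near [S^2 / 2] the root is [S + 1/2 - 1/(8 S)] to second order.
    Taking 1/4 instead of 1/8 leaves about [- S^2 / 4], which absorbs the terms of order [S]. *)
Lemma triples_poly_right (S sg rho : R) : 10 <= S -> S ^+ 2 - 3 <= sg -> rho <= S ^+ 2 / 2 + 5 / 2 ->
  forall t, t = S + 1 / 2 - S^-1 / 4 ->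
  t ^+ 4 - (S ^+ 2 + 1) * t ^+ 2 - sg * t + rho <= 0.
Proof.
move=> S10 sgS rhoS t tdef.
have S0 : S != 0 by lra.
pose g := 1 / 2 - S^-1 / 4.
have i0 : 0 < S^-1 by rewrite invr_gt0; lra.
have i1 : S^-1 <= 10^-1 by rewrite lef_pV2 ?posrE; lra.
have g1 : 475 / 1000 <= g by rewrite /g; lra.
have g2 : g <= 1 / 2 by rewrite /g; lra.
pose e := g ^+ 2 - 1 / 2.
have e1 : - (28 / 100) <= e by rewrite /e; nra.
have e2 : e <= - (25 / 100) by rewrite /e; nra.
have eg : e - g + 1 / 2 <= - (24 / 100) by rewrite /e; nra.
have tE : t = S + g by rewrite tdef /g; lra.
have t2 : t ^+ 2 = S ^+ 2 + S + e by rewrite tdef /e /g; field.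
have -> : t ^+ 4 - (S ^+ 2 + 1) * t ^+ 2 - sg * t + rho =
  t ^+ 2 * (t ^+ 2 - S ^+ 2 - 1) - sg * t + rho by ring.
rewrite t2 tE.
have h1 : (S ^+ 2 - 3) * (S + g) <= sg * (S + g) by apply: ler_wpM2r => //; lra.
have h2 : S ^+ 2 * (e - g + 1 / 2) <= S ^+ 2 * - (24 / 100) by apply: ler_wpM2l => //; exact: sqr_ge0.
have h3 : S * (2 * e + 2) <= S * (3 / 2) by apply: ler_wpM2l; lra.
have h4 : e * (e - 1) <= 1 by nra.
have h5 : 10 * S <= S ^+ 2 by rewrite expr2; apply: ler_wpM2r => //; lra.
have -> : (S ^+ 2 + S + e) * (S ^+ 2 + S + e - S ^+ 2 - 1) - sg * (S + g) + rho =
  S ^+ 2 * (e - g + 1 / 2) + S * (2 * e + 2) + e * (e - 1) + 3 * g + 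
   ((S ^+ 2 - 3) * (S + g) - sg * (S + g)) + (rho - S ^+ 2 / 2) by lra.
lra.
Qed.

(** The same quartic after [t |-> - t], whose large root is the opposite of a negative
    eigenvalue. *)
Lemma triples_poly_left (S sg rho : R) : 10 <= S -> sg <= S ^+ 2 -> rho <= S ^+ 2 / 2 + 5 / 2 ->
  forall t, t = S - 1 / 2 - S^-1 / 4 ->
  t ^+ 4 - (S ^+ 2 + 1) * t ^+ 2 - (- sg) * t + rho <= 0.
Proof.
move=> S10 sgS rhoS t tdef.
have S0 : S != 0 by lra.
pose g := 1 / 2 + S^-1 / 4.
have i0 : 0 < S^-1 by rewrite invr_gt0; lra.
have i1 : S^-1 <= 10^-1 by rewrite lef_pV2 ?posrE; lra.
have g1 : 1 / 2 <= g by rewrite /g; lra.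
have g2 : g <= 525 / 1000 by rewrite /g; lra.
pose e := g ^+ 2 - 1 / 2.
have e1 : - (25 / 100) <= e by rewrite /e; nra.
have e2 : e <= - (22 / 100) by rewrite /e; nra.
have eg : e - g + 1 / 2 <= - (24 / 100) by rewrite /e; nra.
have tE : t = S - g by rewrite tdef /g; lra.
have t2 : t ^+ 2 = S ^+ 2 - S + e by rewrite tdef /e /g; field.
have -> : t ^+ 4 - (S ^+ 2 + 1) * t ^+ 2 - (- sg) * t + rho =
  t ^+ 2 * (t ^+ 2 - S ^+ 2 - 1) + sg * t + rho by ring.
rewrite t2 tE.
have h1 : sg * (S - g) <= S ^+ 2 * (S - g) by apply: ler_wpM2r => //; lra.
have h2 : S ^+ 2 * (e - g + 1 / 2) <= S ^+ 2 * - (24 / 100) by apply: ler_wpM2l => //; exact: sqr_ge0.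
have h3 : S * (1 - 2 * e) <= S * (3 / 2) by apply: ler_wpM2l; lra.
have h4 : e * (e - 1) <= 1 by nra.
have h5 : 10 * S <= S ^+ 2 by rewrite expr2; apply: ler_wpM2r => //; lra.
have -> : (S ^+ 2 - S + e) * (S ^+ 2 - S + e - S ^+ 2 - 1) + sg * (S - g) + rho =
  S ^+ 2 * (e - g + 1 / 2) + S * (1 - 2 * e) + e * (e - 1) +
   (sg * (S - g) - S ^+ 2 * (S - g)) + (rho - S ^+ 2 / 2) by lra.
lra.
Qed.

Lemma triples_spread_ge (n : nat) (S : R) : 10 <= S -> S ^+ 2 = n%:R ->
  2 * S - 1 / 2 * S^-1 <= spread R (triples (n %/ 4) n).
Proof.
move=> S10 SE; set s := (n %/ 4)%N.
have n100 : (100 <= n)%N by rewrite -(ler_nat R) -SE; nra.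
have s4 : (4 * s <= n)%N by rewrite /s; lia.
have s4' : (n <= 4 * s + 3)%N by rewrite /s; lia.
have sn : (3 * s < n)%N by lia.
have i0 : 0 < S^-1 by rewrite invr_gt0; lra.
have i1 : S^-1 <= 10^-1 by rewrite lef_pV2 ?posrE; lra.
have sg1 : 4 * s%:R <= S ^+ 2 by rewrite SE -natrM ler_nat.
have sg2 : S ^+ 2 - 3 <= 4 * s%:R by rewrite lerBlDr SE -natrM -natrD ler_nat.
set r := (n - 1 - 3 * s)%:R : R.
have rE : r = S ^+ 2 - 1 - 3 * s%:R by rewrite SE /r !natrB ?natrM //; lia.
have rho1 : 2 * r <= S ^+ 2 / 2 + 5 / 2 by rewrite rE; lra.
have rho0 : 0 <= r by exact: ler0n.
have s0 : 0 <= s%:R :> R by exact: ler0n.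
have big : 100 <= S ^+ 2 by rewrite SE ler_nat.
have bigS : S <= S ^+ 2 by rewrite expr2 ler_peMr; lra.
(* Provides the sign at [S ^+ 2 + 2], the right end of the interval on which both quartics change
   sign. *)
have B4 : 0 <= (S ^+ 2 + 2) ^+ 4 - (S ^+ 2 + 1) * (S ^+ 2 + 2) ^+ 2 - S ^+ 2 * (S ^+ 2 + 2).
  move: big; set N := S ^+ 2; move=> N100.
  have -> : (N + 2) ^+ 4 - (N + 1) * (N + 2) ^+ 2 - N * (N + 2) =
    (N + 2) * ((N + 2) * (N * (N + 3) + 3) - N) by ring.
  by apply: mulr_ge0; nra.
have ev (t : R) : 5 <= t \/ t <= - 5 ->
    t ^+ 4 - (S ^+ 2 + 1) * t ^+ 2 - 4 * s%:R * t + 2 * r = 0 ->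
    eigenvalue (adj_mx R (triples s n)) t.
  move=> t5 pt; apply: triples_eigenvalue => //; last by rewrite -SE.
    by apply/eqP; lra.
  by apply: lt0r_neq0; case: t5 => t5; nra.
have [||t1 t1S /ev e1] := @quartic_root (S ^+ 2 + 1) (4 * s%:R) (2 * r) (S + 1 / 2 - S^-1 / 4) (S ^+ 2 + 2) _ (triples_poly_right S10 sg2 rho1 erefl).
- lra.
- have : 4 * s%:R * (S ^+ 2 + 2) <= S ^+ 2 * (S ^+ 2 + 2) by apply: ler_wpM2r => //; lra.
  by move: B4 rho0; lra.
have [||t2 t2S pt2] := @quartic_root (S ^+ 2 + 1) (- (4 * s%:R)) (2 * r) (S - 1 / 2 - S^-1 / 4) (S ^+ 2 + 2) _ (triples_poly_left S10 sg1 rho1 erefl).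
- lra.
- have : 0 <= 4 * s%:R * (S ^+ 2 + 2) by apply: mulr_ge0; lra.
  have : 0 <= S ^+ 2 * (S ^+ 2 + 2) by apply: mulr_ge0; lra.
  by move: B4 rho0; lra.
have e2 : eigenvalue (adj_mx R (triples s n)) (- t2).
  by apply: ev; [right; lra|rewrite -pt2; ring].
have := lambda_max_ge (e1 _); have := lambda_min_le e2; rewrite /spread.
have t15 : 5 <= t1 \/ t1 <= -5 by left; lra.
by move=> h2 /(_ t15) h1; lra.
Qed.

End TriplesSpread.

(** * Eigenvalue expansion at the hub *)

Lemma le_sqr (R : realDomainType) (x y : R) : 0 <= x -> x <= y -> x ^+ 2 <= y ^+ 2.
Proof. by move=> x0 xy; rewrite !expr2; apply: ler_pM. Qed.

Section SparseSpectrum.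
Variables (R : realType) (n : nat) (G : sgraph n).

Definition adjr (u v : 'I_n) : R := (G u v)%:R.
Local Notation A := adjr.

Definition degr (u : 'I_n) : R := \sum_v A u v.

Hypothesis codeg : forall u v, u != v -> \sum_k A u k * A v k <= 2.
Hypothesis degsum : \sum_u degr u <= 8 * n%:R.

Lemma adjr_sym u v : A u v = A v u. Proof. by rewrite /A adj_sym. Qed.
Lemma adjr_irrefl u : A u u = 0. Proof. by rewrite /A adj_irrefl. Qed.
Lemma adjr_ge0 u v : 0 <= A u v. Proof. exact: ler0n. Qed.
Lemma adjr_le1 u v : A u v <= 1. Proof. by rewrite /A; case: (G u v); rewrite ?ler01. Qed.
Lemma adjr_idem u v : A u v * A u v = A u v.
Proof. by rewrite /A; case: (G u v); rewrite ?mulr1 ?mulr0. Qed.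

Lemma degr_le u : degr u <= n%:R.
Proof.
rewrite -[n in n%:R]card_ord -sumr_const; apply: ler_sum => v _; exact: adjr_le1.
Qed.

Lemma degr_pair_le u v : u != v -> degr u + degr v <= n%:R + 2.
Proof.
move=> /codeg uv; apply: le_trans (lerD (lexx _) uv).
rewrite -[n in n%:R]card_ord -sumr_const -!big_split /=; apply: ler_sum => k _.
by rewrite /A; case: (G u k); case: (G v k); rewrite ?mulr0 ?mul0r ?mulr1 ?addr0 ?add0r ?ler01 ?lexx.
Qed.

Definition eigenpair (a : R) (y : 'I_n -> R) :=
  (forall u, `|y u| <= 1) /\ (forall u, \sum_k A u k * y k = a * y u).

Lemma eigenpair_sum_le a y : eigenpair a y -> `|a| * \sum_u `|y u| <= 8 * n%:R.
Proof.
move=> [y1 Ey]; apply: le_trans degsum; rewrite mulr_sumr; apply: ler_sum => u _.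
rewrite -normrM -Ey; apply: le_trans (ler_norm_sum _ _ _) _; apply: ler_sum => k _.
by rewrite normrM (ger0_norm (adjr_ge0 _ _)) ler_piMr ?adjr_ge0.
Qed.

(** Applying the equation twice weights [y u] by the codegree of [u] and [v]: the degree if [u = v],
    at most 2 otherwise. *)
Lemma eigenpair_sqr_le a y v : eigenpair a y ->
  a ^+ 2 * `|y v| <= degr v + 2 * \sum_u `|y u|.
Proof.
move=> [y1 Ey].
have -> : a ^+ 2 * `|y v| = `|\sum_u (\sum_k A v k * A u k) * y u|.
  rewrite -[a ^+ 2]ger0_norm ?sqr_ge0 // -normrM; congr (`|_|).
  rewrite expr2 -mulrA -Ey mulr_sumr.
  transitivity (\sum_k \sum_u A v k * A u k * y u).
    apply: eq_bigr => k _; rewrite mulrCA -Ey mulr_sumr; apply: eq_bigr => u _.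
    by rewrite (adjr_sym k u) mulrA.
  by rewrite exchange_big; apply: eq_bigr => u _; rewrite mulr_suml.
apply: le_trans (ler_norm_sum _ _ _) _.
have cd0 u : 0 <= \sum_k A v k * A u k.
  by apply: sumr_ge0 => k _; rewrite mulr_ge0 ?adjr_ge0.
rewrite (bigD1 v) //= mulr_sumr; apply: lerD.
  rewrite normrM (ger0_norm (cd0 v)); apply: (@le_trans _ _ (\sum_k A v k * A v k)).
    by rewrite ler_piMr.
  by apply: ler_sum => k _; rewrite adjr_idem.
rewrite [leRHS](bigD1 v) //=; apply: ler_wpDl; first by rewrite mulr_ge0.
apply: ler_sum => u uv; rewrite normrM (ger0_norm (cd0 u)).
by apply: ler_wpM2r => //; apply: codeg; rewrite eq_sym.
Qed.

Variable S : R.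
Hypotheses (S_ge : 200 <= S) (SE : S ^+ 2 = n%:R).

Lemma eigenpair_norm_le a y v : eigenpair a y -> `|y v| = 1 -> `|a| <= S + 8.
Proof.
have S200 := S_ge.
move=> ey yv.
(* Eliminating [Y] gives [al * (al ^+ 2 - S ^+ 2) <= 16 * S ^+ 2], which fails beyond [S + 8]. *)
have key (al Y dv : R) : 0 <= al -> dv <= S ^+ 2 -> al * Y <= 8 * S ^+ 2 ->
    al ^+ 2 <= dv + 2 * Y -> al <= S + 8; last first.
  apply: (key _ (\sum_u `|y u|) (degr v)); rewrite ?SE ?normr_ge0 ?degr_le //.
    exact: eigenpair_sum_le.
  by have := eigenpair_sqr_le v ey; rewrite yv mulr1 real_normK ?num_real.
move=> al0 h1 h2 h3.
rewrite leNgt; apply/negP => alS.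
have h4 : al * al ^+ 2 <= al * (dv + 2 * Y) by apply: ler_wpM2l.
have h5 : al * dv <= al * S ^+ 2 by apply: ler_wpM2l.
have h6 : (S + 8) ^+ 2 <= al ^+ 2 by apply: le_sqr; lra.
have h7 : S * (16 * S + 64) <= al * (al ^+ 2 - S ^+ 2).
  by move: h6; rewrite sqrrD => h6; apply: ler_pM; lra.
move: h7 h4; rewrite !mulrDr mulrN; lra.
Qed.

Lemma eigenpair_sum_bound a y : eigenpair a y -> S - 9 <= `|a| -> \sum_u `|y u| <= 16 * S.
Proof.
have S200 := S_ge.
move=> ey aS; have := eigenpair_sum_le ey; rewrite -SE => h.
have Y0 : 0 <= \sum_u `|y u| by apply: sumr_ge0.
have h1 : S / 2 * \sum_u `|y u| <= `|a| * \sum_u `|y u| by apply: ler_wpM2r => //; lra.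
rewrite -(@ler_pM2l _ (S / 2)); lra.
Qed.

(** [(S - 9)^2] minus twice the bound [16 S] on the entry sum exceeds [S^2 - 50 S]. *)
Lemma eigenpair_degr_ge a y v : eigenpair a y -> `|y v| = 1 -> S - 9 <= `|a| ->
  S ^+ 2 - 50 * S <= degr v.
Proof.
have S200 := S_ge.
move=> ey yv aS; have := eigenpair_sqr_le v ey; rewrite yv mulr1 -(real_normK (num_real a)).
have := eigenpair_sum_bound ey aS.
have : (S - 9) ^+ 2 <= `|a| ^+ 2 by apply: le_sqr; lra.
by rewrite sqrrB; lra.
Qed.

Lemma degr_large_unique v w : S ^+ 2 - 50 * S <= degr v -> S ^+ 2 - 50 * S <= degr w ->
  v = w.
Proof.
have S200 := S_ge.
move=> hv hw; apply/eqP; apply: contraT => /degr_pair_le; rewrite -SE.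
by have : 200 * S <= S * S by [apply: ler_wpM2r; lra]; rewrite -expr2; lra.
Qed.

Variable w : 'I_n.
Hypothesis w_large : S ^+ 2 - 50 * S <= degr w.

Lemma degr_small u : u != w -> degr u <= 51 * S.
Proof. have S200 := S_ge. by move=> /degr_pair_le; rewrite -SE; move: w_large; lra. Qed.

(** [a^2 |y u|] is at most [51 S + 32 S], and [a^2] at least [S^2 / 4]; 332 is [4 * 83]. *)
Lemma eigenpair_small a y u : eigenpair a y -> S - 9 <= `|a| -> u != w ->
  `|y u| * S <= 332.
Proof.
have S200 := S_ge.
move=> ey aS uw; have h1 := eigenpair_sqr_le u ey; have h2 := degr_small uw.
have h3 := eigenpair_sum_bound ey aS.
have h4 : (S / 2) ^+ 2 <= a ^+ 2 by rewrite -(real_normK (num_real a)); apply: le_sqr; lra.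
have h5 : (S / 2) ^+ 2 * `|y u| <= a ^+ 2 * `|y u| by apply: ler_wpM2r.
rewrite -(@ler_pM2l _ S); last by lra.
have -> : S * (`|y u| * S) = 4 * ((S / 2) ^+ 2 * `|y u|) by field.
lra.
Qed.

(** [N] and [M] are the indicators of the neighbours and of the other non-neighbours of [w], and [B]
    is the adjacency of [G - w]. [h v] and [c v] count the walks of one and two steps in [G - w]
    from the neighbourhood of [w] to [v]. *)
Let N v := A w v.
Let B u v : R := if (u == w) || (v == w) then 0 else A u v.
Let M v : R := if v == w then 0 else 1 - N v.
Let D u := \sum_v B u v.
Let h v := \sum_k N k * B k v.
Let c v := \sum_k h k * B k v.

Let Nw : N w = 0. Proof. exact: adjr_irrefl. Qed.
Let N0 v : 0 <= N v. Proof. exact: adjr_ge0. Qed.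
Let N1 v : N v <= 1. Proof. exact: adjr_le1. Qed.
Let M0 v : 0 <= M v. Proof. by rewrite /M; case: eqP => // _; rewrite subr_ge0. Qed.
Let B0 u v : 0 <= B u v. Proof. by rewrite /B; case: ifP => // _; exact: adjr_ge0. Qed.
Let BA u v : B u v <= A u v. Proof. by rewrite /B; case: ifP => // _; exact: adjr_ge0. Qed.
Let Bsym u v : B u v = B v u. Proof. by rewrite /B orbC adjr_sym. Qed.
Let Bidem u v : B u v * B u v = B u v.
Proof. by rewrite /B; case: ifP; rewrite ?mulr0 ?adjr_idem. Qed.
Let BNM u v : B u v = N v * B u v + M v * B u v.
Proof.
have S200 := S_ge.
rewrite /M; case: eqP => [->|_]; last by lra.
by rewrite /B eqxx orbT !mulr0 addr0.
Qed.
Let codegB u v : u != v -> \sum_k B u k * B v k <= 2.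
Proof.
move=> uv; apply: le_trans (codeg uv); apply: ler_sum => k _.
by apply: ler_pM.
Qed.
Let D0 u : 0 <= D u. Proof. exact: sumr_ge0. Qed.
Let DdegrD u : D u <= degr u. Proof. exact: ler_sum. Qed.
Let h0 v : 0 <= h v. Proof. by apply: sumr_ge0 => k _; exact: mulr_ge0. Qed.
Let hw : h w = 0.
Proof. by apply: big1 => k _; rewrite /B eqxx orbT mulr0. Qed.
Let h2 v : h v <= 2.
Proof.
have [->|vw] := eqVneq v w; first by rewrite hw.
apply: le_trans (codeg vw); apply: ler_sum => k _.
by rewrite mulrC Bsym; apply: ler_wpM2r.
Qed.
Let c0 v : 0 <= c v. Proof. by apply: sumr_ge0 => k _; exact: mulr_ge0. Qed.
Let cD v : c v <= 2 * D v.
Proof. by rewrite mulr_sumr; apply: ler_sum => k _; rewrite Bsym; apply: ler_wpM2r. Qed.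

Definition missing : R := n%:R - 1 - degr w.

Let sumM : \sum_v M v = missing.
Proof.
rewrite /missing /degr (bigD1 w) //= (bigD1 w (P := xpredT)) //=.
rewrite /M eqxx add0r -/(N w) Nw add0r.
rewrite (eq_bigr (fun v => 1 - N v)); last by move=> v /negPf ->.
rewrite sumrB sumr_const /N; congr (_ - _).
have cE : (#|predC1 w|.+1 = n)%N.
  by rewrite cardC1 card_ord prednK // (leq_trans _ (ltn_ord w)).
by apply/esym/eqP; rewrite subr_eq natr1 eqr_nat; apply/eqP; exact: esym cE.
Qed.

Let missing0 : 0 <= missing. Proof. by rewrite -sumM; exact: sumr_ge0. Qed.
Let missing_le : missing <= 50 * S.
Proof. have S200 := S_ge. by rewrite /missing -SE; move: w_large; lra. Qed.

Let m u := \sum_v M v * B u v.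

(** Expanding the square gives codegrees of pairs of missing vertices: at most 2 off the diagonal,
    and degrees of at most [51 S] on it. *)
Let sum_m_sqr : \sum_u m u ^+ 2 <= 2 * missing ^+ 2 + 51 * S * missing.
Proof.
have S200 := S_ge.
have -> : \sum_u m u ^+ 2 = \sum_v \sum_v' M v * M v' * \sum_u B v u * B v' u.
  transitivity (\sum_u \sum_v \sum_v' M v * M v' * (B v u * B v' u)).
    apply: eq_bigr => u _; rewrite expr2 mulr_suml; apply: eq_bigr => v _.
    rewrite mulr_sumr; apply: eq_bigr => v' _; rewrite (Bsym v) (Bsym v').
    by rewrite mulrACA.
  rewrite exchange_big; apply: eq_bigr => v _.
  by rewrite exchange_big; apply: eq_bigr => v' _; rewrite mulr_sumr.
have -> : 2 * missing ^+ 2 + 51 * S * missing =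
    \sum_v (\sum_v' M v * M v' * 2 + 51 * S * M v).
  rewrite big_split /= -!mulr_sumr -sumM; congr (_ + _).
  rewrite expr2 mulr_suml mulr_sumr; apply: eq_bigr => v _.
  by rewrite -mulr_suml -mulr_sumr mulrC.
apply: ler_sum => v _; rewrite (bigD1 v) //= [\sum_(v' < n) M v * _ * 2](bigD1 v) //=.
rewrite addrAC addrC [leRHS]addrC; apply: lerD.
  apply: ler_sum => v' vv'; apply: ler_wpM2l; first exact: mulr_ge0.
  by apply: codegB; rewrite eq_sym.
apply: ler_wpDl; first by rewrite !mulr_ge0.
rewrite /M; case: eqVneq => [_|vw]; first by rewrite !mul0r mulr0.
rewrite -/(N v); have -> : \sum_u B v u * B v u = D v.
  by apply: eq_bigr => u _; exact: Bidem.
have DS : D v <= 51 * S by exact: le_trans (DdegrD v) (degr_small vw).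
have NN : (1 - N v) * (1 - N v) = 1 - N v.
  by have := adjr_idem w v; rewrite -/(N v); lra.
by rewrite NN mulrC; apply: ler_wpM2r => //; rewrite subr_ge0.
Qed.

(** The edge count together with [D u <= 51 * S] would only give order [S^3]. Splitting [D = h + m]
    gives order [S^2], since [h <= 2] and only [O(S)] vertices are missing. *)
Let sum_D_sqr : \sum_u D u ^+ 2 <= 16 * 1000 * S ^+ 2.
Proof.
have S200 := S_ge.
have DE u : D u = h u + m u.
  rewrite /D /h /m -big_split /=; apply: eq_bigr => v _.
  by rewrite {1}BNM (Bsym v u).
apply: (@le_trans _ _ (\sum_u (8 + 2 * m u ^+ 2))).
  apply: ler_sum => u _; rewrite DE.
  have : h u ^+ 2 <= 4 by have := h0 u; have := h2 u; nra.
  have := sqr_ge0 (h u - m u); rewrite sqrrB sqrrD; lra.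
rewrite big_split /= sumr_const card_ord -[8 *+ n]mulr_natr -SE -mulr_sumr.
have := sum_m_sqr; have : missing ^+ 2 <= (50 * S) ^+ 2 by apply: le_sqr.
have : S * missing <= S * (50 * S) by apply: ler_wpM2l => //; lra.
by have := sqr_ge0 S; lra.
Qed.

Definition hub_edges : R := \sum_v h v * N v.

Lemma hub_edges_ge0 : 0 <= hub_edges.
Proof. by apply: sumr_ge0 => v _; exact: mulr_ge0. Qed.

Lemma hub_edges_le : hub_edges <= 2 * S ^+ 2.
Proof.
rewrite SE mulr_natr -[n in _ *+ n]card_ord -sumr_const; apply: ler_sum => v _.
by rewrite -[leRHS]mulr1; apply: ler_pM.
Qed.

(** [h <= 2] gives [h^2 <= 2 h]; the part outside the neighbourhood of [w] costs at most 4 for each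
    missing vertex. *)
Let sum_h_sqr : \sum_v h v ^+ 2 <= 2 * hub_edges + 200 * S.
Proof.
have S200 := S_ge.
apply: (@le_trans _ _ (\sum_v (2 * (h v * N v) + 4 * M v))).
  apply: ler_sum => v _.
  rewrite /M; case: eqVneq => [->|_]; first by rewrite hw expr2 !mul0r !mulr0 addr0.
  have hN : h v ^+ 2 <= 2 * h v by rewrite expr2; apply: ler_wpM2r.
  have : h v * (1 - N v) <= 2 * (1 - N v) by apply: ler_wpM2r; rewrite ?subr_ge0.
  lra.
by rewrite big_split /= -!mulr_sumr sumM; move: missing_le; rewrite /hub_edges; lra.
Qed.

(* Eliminating the entry 1 of y at w from the eigenvalue equation and iterating it
   three times expands a^4 in walks of G - w starting at neighbours of w. *)
Lemma eigenpair_quartic a y : eigenpair a y -> y w = 1 -> S - 9 <= `|a| ->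
  a ^+ 4 <= degr w * a ^+ 2 + hub_edges * a + 2 * hub_edges
            + (200 * 60 * 1000 + 200) * S.
Proof.
have S200 := S_ge.
move=> ey yw aS; have [y1 Ey] := ey.
pose x v := if v == w then 0 else y v.
have Ex u : a * x u = N u + \sum_v B u v * x v.
  rewrite /x; case: eqVneq => [->|uw].
    rewrite mulr0 Nw add0r big1 // => v _; by rewrite /B eqxx mul0r.
  rewrite -Ey (bigD1 w) //= yw mulr1 adjr_sym; congr (_ + _).
  rewrite [RHS](bigD1 w) //= eqxx mulr0 add0r; apply: eq_bigr => v vw.
  by rewrite /B (negPf uw) (negPf vw).
have step (f : 'I_n -> R) : a * (\sum_u f u * x u) =
    \sum_u f u * N u + \sum_v (\sum_u f u * B u v) * x v.
  rewrite mulr_sumr.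
  transitivity (\sum_u (f u * N u + \sum_v f u * B u v * x v)).
    apply: eq_bigr => u _; rewrite mulrCA Ex mulrDr; congr (_ + _).
    by rewrite mulr_sumr; apply: eq_bigr => v _; rewrite mulrA.
  rewrite big_split /=; congr (_ + _); rewrite exchange_big.
  by apply: eq_bigr => v _; rewrite mulr_suml.
(* The equation at [w] itself; the powers of [a] follow by repeated use of [step]. *)
have aE : a = \sum_u N u * x u.
  rewrite -[LHS]mulr1 -yw -Ey (bigD1 w) //= -/(N w) Nw mul0r add0r.
  rewrite [RHS](bigD1 w) //= Nw mul0r add0r; apply: eq_bigr => v vw.
  by rewrite /x (negPf vw).
have E2 : a ^+ 2 = degr w + \sum_v h v * x v.
  rewrite expr2 {2}aE step; congr (_ + _); apply: eq_bigr => v _.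
  exact: adjr_idem.
have E3 : a ^+ 3 = degr w * a + hub_edges + \sum_v c v * x v.
  by rewrite exprS E2 mulrDr step -addrA mulrC.
have E4 : a ^+ 4 = degr w * a ^+ 2 + hub_edges * a + \sum_v h v ^+ 2
    + \sum_v (\sum_u c u * B u v) * x v.
  rewrite exprS E3 mulrDr step.
  have -> : \sum_u c u * N u = \sum_v h v ^+ 2.
    transitivity (\sum_u \sum_k h k * (N u * B u k)).
      apply: eq_bigr => u _; rewrite mulr_suml; apply: eq_bigr => k _.
      by rewrite (Bsym k) -mulrA [X in _ * X]mulrC.
    by rewrite exchange_big; apply: eq_bigr => k _; rewrite -mulr_sumr expr2.
  rewrite addrA; congr (_ + _ + _).
  by move: (degr w) hub_edges => dw b; rewrite mulrDr expr2 mulrCA [a * b]mulrC.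
(* Entries off the hub are at most [332 / S], and the weights total at most twice the sum of the
   [D u ^+ 2], of order [S^2]. *)
have R_le : \sum_v (\sum_u c u * B u v) * x v <= 200 * 60 * 1000 * S.
  have e0 v : 0 <= \sum_u c u * B u v by apply: sumr_ge0 => u _; exact: mulr_ge0.
  rewrite -(@ler_pM2r _ S); last by lra.
  rewrite mulr_suml; apply: (@le_trans _ _ (\sum_v (\sum_u c u * B u v) * 332)).
    apply: ler_sum => v _; rewrite -mulrA; apply: ler_wpM2l => //.
    rewrite /x; case: eqVneq => [_|vw]; first by rewrite mul0r ler0n.
    apply: le_trans (eigenpair_small ey aS vw); apply: ler_wpM2r; first by lra.
    exact: ler_norm.
  rewrite -mulr_suml exchange_big /=.
  have : \sum_u \sum_v c u * B u v <= \sum_u 2 * D u ^+ 2.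
    apply: ler_sum => u _; rewrite -mulr_sumr -/(D u) expr2 mulrA.
    exact: ler_wpM2r.
  rewrite -mulr_sumr; have := sum_D_sqr; rewrite -[200 * _ * _ * S * S]mulrA -expr2.
  have := sqr_ge0 S; lra.
by rewrite E4; have := sum_h_sqr; lra.
Qed.

End SparseSpectrum.

(** * The upper bound for the spread *)

Section QuarticBound.
Variable R : realType.

(* With c = -1 + b - 3b^2/8, the positive root is S + be/2 + c/S + O(1/S^2);
   the summand 1/100 absorbs the error. *)
Definition second_order (b : R) : R := - 1 + b - 3 / 8 * b ^+ 2 + 1 / 100.

(** The quartic is positive at the claimed bound [t] and grows beyond it, so [a > t] is impossible.
    The sign [be] treats both ends of the spectrum at once. *)
Lemma quartic_bound (C S d b be a : R) : 0 <= C -> 100 * (C + 30) <= S ->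
  0 <= b <= 2 -> be = b \/ be = - b -> d <= S ^+ 2 - 2 -> S - 9 <= a ->
  a ^+ 4 <= d * a ^+ 2 + (be * S ^+ 2) * a + 2 * (b * S ^+ 2) + C * S ->
  a <= S + be / 2 + second_order b * S^-1.
Proof.
move=> C0 SC /andP[b0 b2] beb dS aS qa.
have S1 : 3000 <= S by clear - C0 SC; lra.
have S0 : S != 0 by lra.
have [be1 be2] : - 2 <= be /\ be <= 2 by case: beb => ->; lra.
have beb2 : be ^+ 2 = b ^+ 2 by case: beb => ->; rewrite ?sqrrN.
set c := second_order b.
have c1 : - 1 <= c by rewrite /c /second_order; nra.
have c2 : c <= 1 by rewrite /c /second_order; nra.
have i0 : 0 < S^-1 by rewrite invr_gt0; lra.
have i1 : S^-1 <= 100^-1 by rewrite lef_pV2 ?posrE //; clear - S1; lra.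
have Si : S * S^-1 = 1 by rewrite divff.
pose ci := c * S^-1.
have [ci1 ci2] : - (1 / 100) <= ci /\ ci <= 1 / 100 by rewrite /ci; clear - c1 c2 i0 i1; split; nra.
have Sci : S * ci = c by rewrite /ci mulrCA Si mulr1.
pose g := be / 2 + ci.
have [g1 g2] : - (102 / 100) <= g /\ g <= 102 / 100 by rewrite /g; clear - be1 be2 ci1 ci2; split; lra.
have -> : S + be / 2 + c * S^-1 = S + g by rewrite /g -/ci addrA.
rewrite leNgt; apply/negP => at0.
set t := S + g in at0.
pose k0 := 2 * c + g ^+ 2.
have k01 : - 2 <= k0 by rewrite /k0; clear - c1 c2 g1 g2; nra.
have k02 : k0 <= 4 by rewrite /k0; clear - c1 c2 g1 g2; nra.
have t2 : t ^+ 2 = S ^+ 2 + be * S + k0.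
  have -> : t ^+ 2 = S ^+ 2 + be * S + 2 * (S * ci) + g ^+ 2 by rewrite /t /g; field.
  by rewrite Sci /k0 addrA.
(* [second_order] is chosen to cancel this coefficient of [S ^+ 2] up to a positive rest, which
   beats the terms of order [S]. *)
have coefE : k0 + 2 + be ^+ 2 - be * g - 2 * b = 2 / 100 + ci ^+ 2.
  by rewrite /k0 /g beb2 /c /second_order -beb2; field.
have ft : 0 < t ^+ 2 * (t ^+ 2 - S ^+ 2 + 2) - be * S ^+ 2 * t - 2 * (b * S ^+ 2) - C * S.
  rewrite t2; have -> : (S ^+ 2 + be * S + k0) * (S ^+ 2 + be * S + k0 - S ^+ 2 + 2)
     - be * S ^+ 2 * t - 2 * (b * S ^+ 2) - C * S =
     S ^+ 2 * (k0 + 2 + be ^+ 2 - be * g - 2 * b) + S * (be * (2 * k0 + 2) - C)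
     + k0 * (k0 + 2) by rewrite /t; ring.
  rewrite coefE.
  have h1 : 0 <= S ^+ 2 * ci ^+ 2 by rewrite mulr_ge0 ?sqr_ge0.
  have h2 : - 20 <= be * (2 * k0 + 2) by clear - be1 be2 k01 k02; nra.
  have h3 : S * (- 20 - C) <= S * (be * (2 * k0 + 2) - C).
    by apply: ler_wpM2l; [clear - S1; lra|clear - h2; lra].
  have h4 : - 1 <= k0 * (k0 + 2) by have := sqr_ge0 (k0 + 1); clear; lra.
  have h5 : S * (100 * (C + 30)) <= S * S.
    by apply: ler_wpM2l => //; clear - S1; lra.
  have h6 : 0 <= S * C by apply: mulr_ge0 => //; clear - S1; lra.
  by move: h1 h3 h4 h5 h6; clear - S1; lra.
have t9 : S * (9 / 10) <= t by rewrite /t; clear - S1 g1; lra.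
have a9 : S * (9 / 10) <= a by clear - S1 aS; lra.
have fa : a ^+ 2 * (a ^+ 2 - S ^+ 2 + 2) - be * S ^+ 2 * a - 2 * (b * S ^+ 2) - C * S <= 0.
  have : d * a ^+ 2 <= (S ^+ 2 - 2) * a ^+ 2 by apply: ler_wpM2r; rewrite ?sqr_ge0.
  by move: qa; clear; lra.
have mono : 0 <= (a - t) * ((a + t) * (a ^+ 2 + t ^+ 2 - S ^+ 2 + 2) - be * S ^+ 2).
  clearbody t; clear - S1 t9 a9 at0 be2.
  apply: mulr_ge0; first by lra.
  have h1 : (S * (9 / 10)) ^+ 2 <= a ^+ 2 by apply: le_sqr; lra.
  have h2 : (S * (9 / 10)) ^+ 2 <= t ^+ 2 by apply: le_sqr; lra.
  have h3 : S * (S ^+ 2 * (6 / 10)) <= (a + t) * (a ^+ 2 + t ^+ 2 - S ^+ 2 + 2).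
    by have s0 := sqr_ge0 S; apply: ler_pM; lra.
  have h4 : S ^+ 2 * 2 <= S ^+ 2 * (S * (6 / 10)) by apply: ler_wpM2l; rewrite ?sqr_ge0 //; lra.
  have h5 : be * S ^+ 2 <= 2 * S ^+ 2 by apply: ler_wpM2r; rewrite ?sqr_ge0.
  lra.
have : (a - t) * ((a + t) * (a ^+ 2 + t ^+ 2 - S ^+ 2 + 2) - be * S ^+ 2) =
  (a ^+ 2 * (a ^+ 2 - S ^+ 2 + 2) - be * S ^+ 2 * a - 2 * (b * S ^+ 2) - C * S)
  - (t ^+ 2 * (t ^+ 2 - S ^+ 2 + 2) - be * S ^+ 2 * t - 2 * (b * S ^+ 2) - C * S) by ring.
by move: ft fa mono; clear; lra.
Qed.

(** The maximum, at [b = 4 / 3], is [- 1/3 + 1/100]. *)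
Lemma second_order_le (b : R) : second_order b <= - (32 / 100).
Proof.
rewrite /second_order; have := sqr_ge0 (b - 4 / 3); rewrite sqrrB; lra.
Qed.

End QuarticBound.

(** * Spread of a graph whose hub misses a vertex *)

Section SpreadUpperBound.
Variables (R : realType) (n : nat) (G : sgraph n).
Hypothesis outerG : outerplanar R G.
Hypothesis connG : sgraph_connected G.

Lemma codegree_real (u v : 'I_n) : u != v -> \sum_k adjr R G u k * adjr R G v k <= 2.
Proof.
move=> uv; rewrite (eq_bigr (fun k => (G u k && G v k)%:R)); last first.
  by move=> k _; rewrite /adjr; case: (G u k); case: (G v k); rewrite ?mulr1 ?mulr0 ?mul0r.
by rewrite -natr_sum ler_nat; exact: codegree_le2 outerG _ _ uv.
Qed.

Lemma sum_degree_real : \sum_u degr R G u <= 8 * n%:R.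
Proof.
rewrite -natrM; apply: le_trans (_ : (\sum_u \sum_v G u v)%N%:R <= _).
  by rewrite natr_sum; apply: ler_sum => u _; rewrite natr_sum.
by rewrite ler_nat; exact: sum_degree_le outerG connG.
Qed.

Lemma eigenpair_opp a (y : 'I_n -> R) : eigenpair G a y -> eigenpair G a (fun u => - y u).
Proof.
move=> [y1 Ey]; split=> u; first by rewrite normrN.
by rewrite mulrN -Ey -sumrN; apply: eq_bigr => k _; rewrite mulrN.
Qed.

Lemma eigenvalue_eigenpair a : eigenvalue (adj_mx R G) a ->
  exists y v, eigenpair G a y /\ y v = 1.
Proof.
move=> /eigenvalue_normalized[y [v [yv y1 Ey]]].
have ey : eigenpair G a y by split.
have [y0|y0] := leP 0 (y v).
  by exists y, v; split => //; move: yv; rewrite ger0_norm.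
exists (fun u => - y u), v; split; first exact: eigenpair_opp.
by move: yv; rewrite ltr0_norm.
Qed.

Let C : R := 200 * 60 * 1000 + 200.

Lemma eigenvalue_gap_le (S l a : R) (x : 'I_n -> R) (w : 'I_n) :
  100 * (C + 30) <= S -> S ^+ 2 = n%:R -> eigenpair G l x -> x w = 1 ->
  degr R G w <= S ^+ 2 - 2 -> eigenvalue (adj_mx R G) a ->
  l - a <= 2 * S - 6 / 10 * S^-1.
Proof.
move=> SC SE ex xw dw /eigenvalue_eigenpair[z [v [ez zv]]].
have C0 : 0 <= C by rewrite /C; lra.
have S200 : 200 <= S by lra.
have i0 : 0 < S^-1 by rewrite invr_gt0; lra.
have i1 : S^-1 <= 1 by rewrite invf_le1; lra.
have nl := eigenpair_norm_le codegree_real sum_degree_real S200 SE ex (v := w).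
have na := eigenpair_norm_le codegree_real sum_degree_real S200 SE ez (v := v).
rewrite leNgt; apply/negP => gap.
have {nl} : `|l| <= S + 8 by apply: nl; rewrite xw normr1.
have {na} : `|a| <= S + 8 by apply: na; rewrite zv normr1.
rewrite !ler_norml => /andP[a1 a2] /andP[l1 l2].
(* Neither [l] nor [- a] exceeds [S + 8], so a gap close to [2 S] forces both to be at least
   [S - 9], and both eigenvectors peak at [w]. *)
have lS : S - 9 <= l by lra.
have aS : S - 9 <= - a by lra.
have lS' : S - 9 <= `|l| by rewrite ger0_norm; lra.
have aS' : S - 9 <= `|a| by rewrite ler0_norm; lra.
have dwl : S ^+ 2 - 50 * S <= degr R G w.
  by apply: (eigenpair_degr_ge codegree_real sum_degree_real S200 SE ex _ lS'); rewrite xw normr1.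
have dvl : S ^+ 2 - 50 * S <= degr R G v.
  by apply: (eigenpair_degr_ge codegree_real sum_degree_real S200 SE ez _ aS'); rewrite zv normr1.
have vw := degr_large_unique codegree_real S200 SE dvl dwl.
rewrite vw in zv.
have ql := eigenpair_quartic codegree_real sum_degree_real S200 SE dwl ex xw lS'.
have qa := eigenpair_quartic codegree_real sum_degree_real S200 SE dwl ez zv aS'.
have := hub_edges_ge0 R G w; have := hub_edges_le codegree_real SE w.
move: ql qa; rewrite -/C; set h := hub_edges R G w => ql qa h2 h0.
have S20 : 0 < S ^+ 2 by rewrite exprn_gt0; lra.
pose b := h / S ^+ 2.
have hE : h = b * S ^+ 2 by rewrite /b divfK ?gt_eqF.
have b02 : 0 <= b <= 2 by rewrite /b divr_ge0 ?ler_pdivrMr // ltW.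
have ul : l <= S + b / 2 + second_order b * S^-1.
  by apply: (@quartic_bound _ C S (degr R G w) b b l) => //; [left|rewrite -hE].
(* Passing to [- a] reverses the sign of the linear term. The contributions [b / 2] and [- b / 2]
   then cancel in the gap, leaving twice [second_order b]. *)
have ua : - a <= S + - b / 2 + second_order b * S^-1.
  apply: (@quartic_bound _ C S (degr R G w) b (- b) (- a)) => //; first by right.
  rewrite mulNr -hE mulrNN sqrrN.
  by have -> : (- a) ^+ 4 = a ^+ 4 by ring.
have : second_order b * S^-1 <= - (32 / 100) * S^-1.
  by apply: ler_wpM2r; [lra|exact: second_order_le].
lra.
Qed.

End SpreadUpperBound.

Theorem theorem3p1 (R : realType) :
  exists N : nat, forall n : nat, (N <= n)%N ->
  forall G : sgraph n,
    sgraph_connected G ->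
    outerplanar R G ->
    (forall H : sgraph n, outerplanar R H -> spread R H <= spread R G) ->
  forall x : 'cV[R]_n,
    adj_mx R G *m x = lambda_max R G *: x ->
    (forall v : 'I_n, 0 < x v ord0) ->
    (forall v : 'I_n, x v ord0 <= 1) ->
    (exists v : 'I_n, x v ord0 = 1) ->
  forall w : 'I_n, x w ord0 = 1 ->
    degree G w = (n - 1)%N.
Proof.
pose C : R := 200 * 60 * 1000 + 200.
have C0 : 0 <= C by rewrite /C; lra.
pose S0 : R := 100 * (C + 30).
have S00 : 0 <= S0 by rewrite /S0; lra.
(* This threshold makes the square root of [n] at least [S0], as the asymptotic estimates
   require. *)
exists (Num.bound (S0 ^+ 2)) => n Nn G conn outer maxG x Ex x_gt0 x_le1 _ w xw.
pose S : R := Num.sqrt n%:R.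
have SE : S ^+ 2 = n%:R by rewrite sqr_sqrtr ?ler0n.
have SS : S0 <= S.
  rewrite -(@ler_pXn2r _ 2) ?nnegrE ?sqrtr_ge0 // SE.
  apply: le_trans (ltW (archi_boundP (sqr_ge0 _))) _.
  by rewrite ler_nat.
have S10 : 10 <= S by apply: le_trans SS; rewrite /S0; lra.
have ex : eigenpair G (lambda_max R G) (fun v => x v ord0).
  split => u; first by rewrite ger0_norm // ltW.
  have /matrixP/(_ u ord0) := Ex; rewrite !mxE => <-.
  by apply: eq_bigr => k _; rewrite mxE.
have el : eigenvalue (adj_mx R G) (lambda_max R G).
  apply: (@eigenvalue_adj_mx _ _ _ _ (fun v => x v ord0) w); first by rewrite xw oner_neq0.
  by case: ex.
have degE : degr R G w = (degree G w)%:R.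
  by rewrite /degr /adjr -natr_sum sum_nat_of_bool.
have deg_lt : (degree G w < n)%N.
  have n0 : (0 < n)%N by exact: leq_trans (ltn_ord w).
  apply: (@leq_ltn_trans #|predC1 w|); last by rewrite cardC1 card_ord prednK.
  apply: subset_leq_card; apply/fintype.subsetP => u; rewrite !inE.
  by apply: contraTneq => ->; rewrite adj_irrefl.
apply/eqP; apply: contraT => nd.
have dw : degr R G w <= S ^+ 2 - 2.
  by rewrite degE SE lerBrDr -natrD ler_nat; lia.
have := maxG _ (triples_outerplanar R (n %/ 4) n).
have := triples_spread_ge S10 SE.
suff : spread R G <= 2 * S - 6 / 10 * S^-1.
  have : 0 < S^-1 by rewrite invr_gt0; lra.
  lra.
rewrite /spread lerBlDl -lerBlDr.
(* The gap estimate holds for every eigenvalue [a], so it passes to their infimum; [lambda_max]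
   shows that the set is nonempty. *)
apply: lb_le_inf; first by exists (lambda_max R G).
move=> a /= ea; have := eigenvalue_gap_le outer conn SS SE ex xw dw ea; lra.
Qed.
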